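(* Let $\mathcal{P}$ be a countable set equipped with a map $N:\mathcal{P}\to\mathbb{Z}_{>1}$, and let $\mathcal{M}$ be the free abelian monoid generated by $\mathcal{P}$; write each $\mathfrak{m}\in\mathcal{M}$ as $\mathfrak{m}=\sum_{\mathfrak{p}\in\mathcal{P}} n_{\mathfrak{p}}(\mathfrak{m})\mathfrak{p}$ with $n_{\mathfrak{p}}(\mathfrak{m})\in\mathbb{Z}_{\ge 0}$, almost all zero, and extend $N$ to $\mathcal{M}$ by $N(\mathfrak{m})=\prod_{\mathfrak{p}} N(\mathfrak{p})^{n_{\mathfrak{p}}(\mathfrak{m})}$. Let $X=\mathbb{Q}$ or $X=\{q^z: z\in\mathbb{Z}\}$ for some $q\in\mathbb{Z}_{>0}$, with $N(\mathcal{M})\subseteq X$, and assume that there are constants $\kappa>0$ and $0\le\theta<1$ such that for all sufficiently large $x\in X$, $$\#\{\mathfrak{m}\in\mathcal{M}: N(\mathfrak{m})\le x\}=\kappa x+O(x^{\theta}).$$ Let $\mathcal{S}\subseteq\mathcal{M}$ be an infinite subset, and for $x\in X$, $x>1$, let $\mathcal{S}(x)=\{\mathfrak{m}\in\mathcal{S}: N(\mathfrak{m})\le x\}$. Assume $|\mathcal{S}(x^{1/2})|=o(|\mathcal{S}(x)|)$ as $x\to\infty$. Let $f:\mathcal{S}\to\mathcal{M}$ be a map. For $\ell\in\mathcal{P}$ write $$\frac{1}{|\mathcal{S}(x)|}\#\{\mathfrak{m}\in\mathcal{S}(x): n_\ell(f(\mathfrak{m}))\ge 1\}=\lambda_\ell+e_\ell(x),$$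 where $\lambda_\ell$ is independent of $x$, and for distinct $\ell_1,\dots,\ell_u\in\mathcal{P}$ define $e_{\ell_1\cdots\ell_u}=e_{\ell_1\cdots\ell_u}(x)$ by $$\frac{1}{|\mathcal{S}(x)|}\#\{\mathfrak{m}\in\mathcal{S}(x): n_{\ell_i}(f(\mathfrak{m}))\ge 1\text{ for all } i=1,\dots,u\}=\lambda_{\ell_1}\cdots\lambda_{\ell_u}+e_{\ell_1\cdots\ell_u}.$$ Suppose there exist $\beta$ with $0<\beta\le 1$ and a function $y=y(x)<x^{\beta}$ such that, as $x\to\infty$: (a) for each $\mathfrak{m}\in\mathcal{S}(x)$, $\#\{\ell\in\mathcal{P}: N(\ell)>x^{\beta},\ n_\ell(f(\mathfrak{m}))\ge 1\}=O_\beta(1)$; (b) $\sum_{y<N(\ell)\le x^\beta}\lambda_\ell=o((\log\log x)^{1/2})$; (c) $\sum_{y<N(\ell)\le x^\beta}|e_\ell|=o((\log\log x)^{1/2})$; (d) $\sum_{N(\ell)\le y}\lambda_\ell=\log\log x+o((\log\log x)^{1/2})$; (e) $\sum_{N(\ell)\le y}\lambda_\ell^2=o((\log\log x)^{1/2})$; (f) for every $r\in\mathbb{Z}_{>0}$ and every $u\in\{1,\dots,r\}$, $\sum|e_{\ell_1\cdots\ell_u}|=o((\log\log x)^{-r/2})$, where the sum runs over all $u$-tuples $(\ell_1,\dots,\ell_u)$ of distinct elements of $\mathcal{P}$ with $N(\ell_i)\le y$ for all $i$. Then for every $\gamma\in\mathbb{R}$, $$\lim_{x\to\infty}\frac{1}{|\mathcal{S}(x)|}\#\left\{\mathfrak{m}\in\mathcal{S}(x):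 N(\mathfrak{m})\ge 3,\ \frac{\omega(f(\mathfrak{m}))-\log\log N(\mathfrak{m})}{\sqrt{\log\log N(\mathfrak{m})}}\le\gamma\right\}=\Phi(\gamma),$$ where $\Phi(\gamma)=\frac{1}{\sqrt{2\pi}}\int_{-\infty}^{\gamma}e^{-u^2/2}\,du$.
   Context: For $\mathfrak{m}\in\mathcal{M}$, $\omega(\mathfrak{m})=\#\{\mathfrak{p}\in\mathcal{P}: n_{\mathfrak{p}}(\mathfrak{m})\ge 1\}$. All limits $x\to\infty$ are taken with $x\in X$. $O_\beta$ means the implied constant depends only on $\beta$. *)

(* Defs.v *)
From HB Require Import structures.
From mathcomp Require Import all_boot all_order all_algebra.
From mathcomp Require Import finmap.
From mathcomp Require Import all_classical all_reals all_analysis.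
Import Order.TTheory GRing.Theory Num.Theory.
Import numFieldNormedType.Exports.
Set Implicit Arguments.
Unset Strict Implicit.
Unset Printing Implicit Defensive.
Local Open Scope classical_set_scope.
Local Open Scope ring_scope.

(* The free abelian monoid on P, as finitely supported functions P -> nat:
   [m p] is the coefficient n_p(m). *)
Definition freeM (P : choiceType) := {fsfun P -> nat with 0%N}.

Definition normM {P : choiceType} (N : P -> nat) (m : freeM P) : nat :=
  (\prod_(p <- finsupp m) N p ^ m p)%N.

(* Cardinality of a finite set; the value is 0 on infinite sets. *)
Definition ncard {T : choiceType} (A : set T) : nat := (#|` fset_set A|)%fset.

Definition omega {P : choiceType} (m : freeM P) : nat :=
  ncard [set p | (1 <= m p)%N].

(* The filter of "x tends to +oo with x in X". *)
Definition infty {R : realType} (X : set R) : set_system R := within X +oo.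

Instance infty_filter {R : realType} (X : set R) : Filter (infty X).
Proof. exact: within_filter. Qed.

(* Required by the Landau notations, which infer the filter structure. *)
Canonical infty_filter_on (R : realType) (X : set R) :=
  FilterType (infty X) (infty_filter X).

Section Counting.
Context {R : realType} {P : choiceType}.
Variable N : P -> nat.

(* S(x) *)
Definition upto (S : set (freeM P)) (x : R) : set (freeM P) :=
  [set m | S m /\ (normM N m)%:R <= x].

(* |S(x)| *)
Definition cupto (S : set (freeM P)) (x : R) : R := (ncard (upto S x))%:R.

(* e_{l_1 ... l_u}(x) for s = [:: l_1; ...; l_u]; e_l is the case s = [:: l].
   The map f is total, but only its values on S are used. *)
Definition err (S : set (freeM P)) (f : freeM P -> freeM P) (lam : P -> R)
    (s : seq P) (x : R) : R :=
  (ncard [set m | upto S x m /\ forall l, l \in s -> (1 <= f m l)%N])%:R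
    / cupto S x - \prod_(l <- s) lam l.

End Counting.

Definition Phi {R : realType} (gamma : R) : R :=
  (Num.sqrt (2 * pi))^-1 *
  (\int[@lebesgue_measure R]_(u in `]-oo, gamma]) expR (- (u ^+ 2 / 2)))%R.

(* Main.v *)
(* Let L = log log x and let W(m) count the primes l with N(l) <= y dividing
   f(m).  Hypothesis (f) says that the factorial moments of W over S(x) agree, up
   to any power of 1/L, with those of a sum of independent Bernoulli variables of
   parameters lambda_l.  Hence so do the moments of Z = (W - L)/sqrt(L), and, by
   Taylor's formula and the exponential moments of the Bernoulli sum, the means of
   cos(t Z + a).  Replacing each factor 1 + lambda_l (e^{is} - 1), s = t/sqrt(L), by
   exp(lambda_l (e^{is} - 1)) costs O(s^2 sum lambda_l^2) = o(1) by (e), and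
   (d) then gives the limit e^{-t^2/2} cos a.  A trigonometric polynomial
   approximates the indicator of a half-line away from its endpoint on a long
   interval, so tightness turns this into convergence of distribution functions.
   Finally omega(f(m)) - W(m) = o(sqrt L) outside o(|S(x)|) elements by (a), (b),
   (c) and Markov's inequality, and log log N(m) = L + O(1) when N(m) > x^{1/2}. *)
Require Import Defs.
From HB Require Import structures.
From mathcomp Require Import all_boot all_order all_algebra.
From mathcomp Require Import finmap.
From mathcomp Require Import all_classical all_reals all_analysis.
From mathcomp Require Import measurable_realfun.
From mathcomp Require Import ring lra.
Import Order.TTheory GRing.Theory Num.Theory.
Import numFieldNormedType.Exports.
Set Implicit Arguments.
Unset Strict Implicit.
Unset Printing Implicit Defensive.
Local Open Scope classical_set_scope.
Local Open Scope ring_scope.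

(** * Trigonometric approximation of half-lines *)

(** The phase [a] in cos(t z + a) keeps the Fourier argument real: closure under products is the
    product-to-sum formula, and the Gaussian side becomes a scalar linear differential equation in
    t. Averages over S(x), the Bernoulli law and the Gaussian integral enter only as normalized
    monotone linear functionals, so no probability space has to be built.

    The averages over S(x) come with no exponential bound. Taylor expansions are therefore cut at an
    even order N, where the remainder |tZ|^N/N! is itself a moment and can be transferred from the
    Bernoulli sum.

    Two facts that the statement leaves implicit have to be proved. Finiteness of S(x): [ncard] is 0
    on infinite sets, and the asymptotic kappa x + O(x^theta) excludes that value for large x. The
    bounds 0 <= lambda_l <= 1: by (d) every fixed prime is eventually counted in N(l) <= y(x), since
    otherwise the sum of the lambda_l over that range would stay below a fixed bound for arbitrarily
    large x; then (f) with u = 1 makes lambda_l a limit of frequencies. *)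

Section TrigPoly.
Context {R : realType}.

(** The phase lets a single generator provide sines (a = -pi/2) and constants (t = 0), so real
    cosines can replace complex exponentials. *)
Inductive trigpoly : (R -> R) -> Prop :=
| TrigCos t a : trigpoly (fun z => cos (t * z + a))
| TrigAdd f g : trigpoly f -> trigpoly g -> trigpoly (fun z => f z + g z)
| TrigScale c f : trigpoly f -> trigpoly (fun z => c * f z).

Lemma trigpoly_ext f g : trigpoly f -> (forall z, f z = g z) -> trigpoly g.
Proof. by move=> tf /funext <-. Qed.

Lemma trigpoly_cst c : trigpoly (fun=> c).
Proof.
apply: (trigpoly_ext (TrigScale c (TrigCos 0 0))) => z.
by rewrite mul0r addr0 cos0 mulr1.
Qed.

(** Double induction down to the product-to-sum formula. Closure under products is what allows a
    polynomial such as [sharpen] to be applied to a sine. *)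
Lemma trigpoly_mul f g : trigpoly f -> trigpoly g -> trigpoly (fun z => f z * g z).
Proof.
move=> tf; elim: tf g => {f} [t a|f1 f2 _ IH1 _ IH2|c f _ IH] g tg.
- elim: tg => {g} [t' a'|g1 g2 _ IH1 _ IH2|c g _ IH].
  + apply: (trigpoly_ext (TrigScale (1/2) (TrigAdd
      (TrigCos (t + t') (a + a')) (TrigCos (t - t') (a - a'))))) => z.
    have -> : (t + t') * z + (a + a') = (t * z + a) + (t' * z + a') by ring.
    have -> : (t - t') * z + (a - a') = (t * z + a) - (t' * z + a') by ring.
    by rewrite cosD cosB; field.
  + apply: (trigpoly_ext (TrigAdd IH1 IH2)) => z; ring.
  + apply: (trigpoly_ext (TrigScale c IH)) => z; ring.
- apply: (trigpoly_ext (TrigAdd (IH1 _ tg) (IH2 _ tg))) => z; ring.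
- apply: (trigpoly_ext (TrigScale c (IH _ tg))) => z; ring.
Qed.

Lemma continuous_trigpoly f : trigpoly f -> continuous f.
Proof.
elim=> {f} [t a|f g _ cf _ cg|c f _ cf] z.
- apply: (@continuous_comp _ _ _ (fun z => t * z + a) cos); last exact: continuous_cos.
  apply: cvgD; last exact: cvg_cst.
  by apply: cvgM; [exact: cvg_cst|exact: cvg_id].
- by apply: cvgD; [exact: cf|exact: cg].
- by apply: cvgM; [exact: cvg_cst|exact: cf].
Qed.

Lemma bounded_trigpoly f : trigpoly f -> exists M, forall z, `|f z| <= M.
Proof.
elim=> {f} [t a|f g _ [M Mf] _ [M' Mg]|c f _ [M Mf]].
- by exists 1 => z; exact: cos_max.
- by exists (M + M') => z; rewrite (le_trans (ler_normD _ _))// lerD.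
- by exists (`|c| * M) => z; rewrite normrM ler_wpM2l.
Qed.

(* A contraction of [-1/2, 1/2] towards the endpoint of the same sign: its
   iterates turn the sine into an approximate sign function. *)
Definition sharpen (w : R) := w * (3 / 2 - 2 * w ^+ 2).

Lemma trigpoly_sharpen n f : trigpoly f -> trigpoly (fun z => iter n sharpen (f z)).
Proof.
move=> tf; elim: n => //= n IH.
apply: (trigpoly_ext (trigpoly_mul IH (TrigAdd (trigpoly_cst (3 / 2))
  (TrigScale (- 2) (trigpoly_mul IH IH))))) => z.
rewrite /sharpen; ring.
Qed.

Lemma sharpenN w : sharpen (- w) = - sharpen w.
Proof. rewrite /sharpen; ring. Qed.

Lemma iter_sharpenN n w : iter n sharpen (- w) = - iter n sharpen w.
Proof. by elim: n => //= n ->; rewrite sharpenN. Qed.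

(** In the variable v = 2w the map is v -> (3v - v^3)/2, the cubic iteration for the sign function,
    so 1/2 is a fixed point with vanishing derivative. The two factorizations make the signs
    visible. *)
Lemma sharpen_itv (w : R) : 0 <= w <= 1 / 2 -> w <= sharpen w <= 1 / 2.
Proof.
rewrite /sharpen => /andP[w0 w1]; apply/andP; split; rewrite -subr_ge0.
  have -> : w * (3 / 2 - 2 * w ^+ 2) - w = 2 * w * ((1 / 2 - w) * (1 / 2 + w)) by field.
  by rewrite !mulr_ge0 ?subr_ge0 ?addr_ge0.
have -> : 1 / 2 - w * (3 / 2 - 2 * w ^+ 2) = (1 / 2 - w) ^+ 2 * (2 * (w + 1)) by field.
by rewrite mulr_ge0 ?sqr_ge0// mulr_ge0// addr_ge0.
Qed.

Lemma iter_sharpen_itv n (w : R) : 0 <= w <= 1 / 2 -> w <= iter n sharpen w <= 1 / 2.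
Proof.
move=> w01; elim: n => [|n /= /andP[IH1 IH2]]; first by rewrite lexx; case/andP: w01.
have /sharpen_itv : 0 <= iter n sharpen w <= 1 / 2.
  by rewrite IH2 andbT (le_trans _ IH1)//; case/andP: w01.
by move=> /andP[h ->]; rewrite (le_trans IH1 h).
Qed.

Lemma iter_sharpen_norm n (w : R) : `|w| <= 1 / 2 -> `|iter n sharpen w| <= 1 / 2.
Proof.
wlog w0 : w / 0 <= w.
  move=> h; have [/h//|/ltW w0] := leP 0 w.
  by rewrite -normrN -(normrN (iter _ _ _)) -iter_sharpenN; apply: h; lra.
rewrite ger0_norm// => w1.
have /andP[h1 h2] := @iter_sharpen_itv n w (introT andP (conj w0 w1)).
by rewrite ger0_norm// (le_trans w0).
Qed.

(* 1/2 - sharpen w = (1/2 - w) (1 - w - 2 w^2) *)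
Lemma iter_sharpen_lower n (w0 w : R) : 0 <= w0 -> w0 <= w <= 1 / 2 ->
  1 / 2 - iter n sharpen w <= (1 - w0) ^+ n.
Proof.
move=> w00 /andP[w0w w1]; elim: n => [|n IH]; first by rewrite expr0 /=; lra.
have /andP[h1 h2] := @iter_sharpen_itv n w (introT andP (conj (le_trans w00 w0w) w1)).
rewrite exprS /=; move: IH h1 h2; set v := iter _ _ _ => IH h1 h2.
apply: (@le_trans _ _ ((1 - w0) * (1 / 2 - v))); last by apply: ler_wpM2l => //; lra.
rewrite /sharpen; nra.
Qed.


Search sin (_ <= _) "norm".

Lemma le_norm_MVT (f df : R -> R) (M a b : R) :
  (forall x : R, is_derive x 1 f (df x)) -> (forall x, `|df x| <= M) ->
  `|f b - f a| <= M * `|b - a|.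
Proof.
move=> fd dM.
wlog ab : a b / a <= b.
  by move=> h; have [/h//|/ltW/h] := leP a b; rewrite distrC (distrC a).
have [c _ ->] := @MVT_segment R f df a b ab (fun v _ => fd v)
   (derivable_within_continuous (fun v _ => @ex_derive _ _ _ _ _ _ _ (fd v))).
by rewrite normrM ler_wpM2r.
Qed.

Lemma le_norm_sin (x : R) : `|sin x| <= `|x|.
Proof.
have := @le_norm_MVT sin cos 1 0 x (fun z => is_derive_sin z) (@cos_max R).
by rewrite sin0 !subr0 mul1r.
Qed.

Lemma cos_ge (x : R) : 1 - x ^+ 2 / 2 <= cos x.
Proof.
have -> : cos x = 1 - 2 * sin (x / 2) ^+ 2.
  rewrite -[in LHS](@mulfVK _ 2 _ x)// mulr_natr cos_mulr2n cos2sin2.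
  rewrite -mulr_natr; ring.
have : sin (x / 2) ^+ 2 <= (x / 2) ^+ 2.
  by rewrite -(real_normK (num_real (sin _))) -(real_normK (num_real (x / 2)))
     lerXn2r ?nnegrE ?le_norm_sin.
have -> : (x / 2) ^+ 2 = x ^+ 2 / 4 by field.
lra.
Qed.

(** On [0, 1] the derivative cos v - 1/2 of sin v - v/2 is nonnegative, because cos v >= 1 - v^2/2
    >= 1/2. *)
Lemma sin_ge_half (u : R) : 0 <= u <= 1 -> u / 2 <= sin u.
Proof.
move=> /andP[u0 u1].
pose g (v : R) := sin v - v / 2.
have gd (v : R) : is_derive v 1 g (cos v - 1 / 2).
  apply: is_deriveB.
  have -> : (fun v : R => v / 2) = (fun v : R => (1 / 2) *: v).
    by apply/funext => z; rewrite /GRing.scale/=; field.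
  by rewrite -[X in is_derive _ _ _ X]mulr1; apply: is_deriveZ.
have [c cin] := @MVT_segment R g _ 0 u u0 (fun v _ => gd v)
   (derivable_within_continuous (fun v _ => @ex_derive _ _ _ _ _ _ _ (gd v))).
rewrite {1 2}/g sin0 mul0r !subr0 -subr_ge0 => ->.
move: cin; rewrite in_itv/= => /andP[c0 c1].
apply: mulr_ge0 => //.
rewrite subr_ge0; apply: le_trans (cos_ge c).
have : c ^+ 2 <= 1 by rewrite expr_le1// (le_trans c1).
lra.
Qed.

(** Approximates the indicator of z <= g, but only in the window |z - g| <= B: there the sine has
    the sign of z - g. The factor 1/2 brings the sine into [-1/2, 1/2], where [sharpen] acts, and
    [n] controls the quality. *)
Definition smooth_step n (B g z : R) := 1 / 2 - iter n sharpen (1 / 2 * sin ((z - g) / B)).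

Lemma trigpoly_smooth_step n B g : trigpoly (smooth_step n B g).
Proof.
have h : trigpoly (fun z => 1 / 2 * sin ((z - g) / B)).
  apply: (trigpoly_ext (TrigScale (1 / 2) (TrigCos B^-1 (- (g / B) - pi / 2)))) => z.
  by rewrite addrA cosBpihalf (mulrC _ z) -mulrBl.
apply: (trigpoly_ext (TrigAdd (trigpoly_cst (1 / 2))
  (TrigScale (-1) (trigpoly_sharpen n h)))) => z.
by rewrite mulN1r.
Qed.

Lemma smooth_step_itv n B g z : 0 <= smooth_step n B g z <= 1.
Proof.
suff : `|iter n sharpen (1 / 2 * sin ((z - g) / B))| <= 1 / 2.
  by rewrite /smooth_step ler_norml => /andP[h1 h2]; apply/andP; split; lra.
apply: iter_sharpen_norm; rewrite normrM ger0_norm ?divr_ge0//.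
by rewrite ler_piMr ?divr_ge0// sin_max.
Qed.

(** The constant d/(4B) is the starting point of the iteration: sin u >= u/2 at u = (z - g)/B >= d/B
    costs one factor 2, the factor 1/2 in front of the sine the other. *)
Lemma smooth_step_right n (B g d z : R) : 0 < B -> 0 <= d -> g + d <= z <= g + B ->
  smooth_step n B g z <= (1 - d / (4 * B)) ^+ n.
Proof.
move=> B0 d0 /andP[dz zB].
have w1 : (z - g) / B / 2 <= sin ((z - g) / B).
  apply: sin_ge_half; rewrite ler_pdivlMr// ler_pdivrMr// mul0r mul1r.
  by apply/andP; split; lra.
apply: iter_sharpen_lower; first by rewrite divr_ge0// mulr_ge0// ltW.
apply/andP; split; last by have := sin_le1 ((z - g) / B); lra.
have : d / B / 2 <= (z - g) / B / 2 by rewrite ler_pM2r// ler_pM2r ?invr_gt0//; lra.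
have -> : d / (4 * B) = d / B / 2 / 2 by field; rewrite gt_eqF.
lra.
Qed.

Lemma smooth_stepN n (B g z : R) : smooth_step n B g z = 1 - smooth_step n B (- g) (- z).
Proof.
rewrite /smooth_step.
have -> : (- z - - g) / B = - ((z - g) / B) by ring.
rewrite sinN mulrN iter_sharpenN; lra.
Qed.

Lemma smooth_step_left n (B g d z : R) : 0 < B -> 0 <= d -> g - B <= z <= g - d ->
  1 - (1 - d / (4 * B)) ^+ n <= smooth_step n B g z.
Proof.
move=> B0 d0 /andP[dz zB]; rewrite smooth_stepN.
have := @smooth_step_right n B (- g) d (- z) B0 d0.
have -> : - g + d <= - z <= - g + B by apply/andP; split; lra.
by move=> /(_ isT); lra.
Qed.
End TrigPoly.

(** * Convergence of distribution functions from convergence of cosine means and tightness *)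

Section Comparison.
Context {R : realType}.

Definition bounded_measurable (g : R -> R) :=
  measurable_fun [set: R] g /\ exists M, forall z, `|g z| <= M.

(** Covers both the finite averages and the Gaussian integral. Linearity and monotonicity are asked
    only of bounded measurable functions, where the Gaussian integral is finite. *)
Record is_mean (E : (R -> R) -> R) : Prop := IsMean {
  mean1 : E (fun=> 1) = 1;
  meanD : forall g h, bounded_measurable g -> bounded_measurable h ->
    E (fun z => g z + h z) = E g + E h;
  meanZ : forall c g, bounded_measurable g -> E (fun z => c * g z) = c * E g;
  mean_le : forall g h, bounded_measurable g -> bounded_measurable h ->
    (forall z, g z <= h z) -> E g <= E h }.

Lemma bounded_measurable_cst (c : R) : bounded_measurable (fun=> c).
Proof. by split; [exact: measurable_cst|exists `|c|]. Qed.

Lemma bounded_measurableD g h : bounded_measurable g -> bounded_measurable h ->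
  bounded_measurable (fun z => g z + h z).
Proof.
move=> [mg [M gM]] [mh [M' hM]]; split; first exact: measurable_funD.
by exists (M + M') => z; rewrite (le_trans (ler_normD _ _))// lerD.
Qed.

Lemma bounded_measurable_trigpoly g : trigpoly g -> bounded_measurable g.
Proof.
move=> tg; split; last exact: bounded_trigpoly.
by apply: continuous_measurable_fun => z; exact: continuous_trigpoly.
Qed.

Lemma bounded_measurable_indic (A : set R) : measurable A -> bounded_measurable (\1_A).
Proof.
move=> mA; split; first exact: measurable_indic.
by exists 1 => z; rewrite indicE; case: (_ \in _); rewrite ?normr0 ?normr1.
Qed.

Lemma meanDcst (E : (R -> R) -> R) g c : is_mean E -> bounded_measurable g ->
  E (fun z => g z + c) = E g + c.
Proof.
move=> hE mg.
rewrite meanD//; last exact: bounded_measurable_cst.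
congr (_ + _); rewrite -[RHS]mulr1 -(mean1 hE).
rewrite -meanZ//; last exact: bounded_measurable_cst.
by congr E; apply/funext => z; rewrite mulr1.
Qed.

Definition far (c B : R) : set R := [set z | B < `|z - c|].
Definition below (c : R) : set R := [set z | z <= c].

Lemma measurable_below c : measurable (below c).
Proof.
have -> : below c = [set` `]-oo, c]] by apply/seteqP; split => z; rewrite /= in_itv.
exact: measurable_itv.
Qed.

Lemma measurable_far c B : measurable (far c B).
Proof.
have -> : far c B = [set` `]-oo, (c - B)%R[] `|` [set` `](c + B)%R, +oo[] .
  apply/seteqP; split => z; rewrite /far /= !in_itv/= andbT.
    by rewrite ltNge ler_norml negb_and -!ltNge => /orP[h|h]; [left|right]; lra.
  by move=> h; rewrite ltNge ler_norml negb_and -!ltNge; apply/orP; case: h => h; [left|right]; lra.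
by apply: measurableU; exact: measurable_itv.
Qed.

(** Outside the window the indicator of [far] pays for everything, since the smooth step is
    nonnegative; inside it, [smooth_step_left] leaves only the power of 1 - d/(4B). *)
Lemma le_smooth_step n (B g d z : R) : 0 < B -> 0 <= d -> d <= 4 * B ->
  \1_(below (g - d)) z <= smooth_step n B g z + (1 - d / (4 * B)) ^+ n + \1_(far g B) z.
Proof.
move=> B0 d0 dB; rewrite !indicE.
have /andP[s0 s1] := smooth_step_itv n B g z.
have e0 : 0 <= (1 - d / (4 * B)) ^+ n.
  by rewrite exprn_ge0// subr_ge0 ler_pdivrMr ?mul1r// mulr_gt0.
have [_|] := boolP (z \in far g B); first by case: (_ \in _) => /=; rewrite ?mulr1n ?mulr0n; lra.
rewrite notin_setE/= => /negP; rewrite -leNgt ler_norml => /andP[h1 h2].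
have [|] := boolP (z \in below (g - d)); rewrite ?inE ?notin_setE /below /= => h;
  rewrite ?mulr0n ?mulr1n; last lra.
have := @smooth_step_left _ n B g d z B0 d0.
have -> : g - B <= z <= g - d by apply/andP; split; lra.
by move=> /(_ isT); lra.
Qed.

Lemma ge_smooth_step n (B g d z : R) : 0 < B -> 0 <= d -> d <= 4 * B ->
  smooth_step n B g z <= \1_(below (g + d)) z + (1 - d / (4 * B)) ^+ n + \1_(far g B) z.
Proof.
move=> B0 d0 dB; rewrite !indicE.
have /andP[s0 s1] := smooth_step_itv n B g z.
have e0 : 0 <= (1 - d / (4 * B)) ^+ n.
  by rewrite exprn_ge0// subr_ge0 ler_pdivrMr ?mul1r// mulr_gt0.
have [_|] := boolP (z \in far g B); first by case: (_ \in _) => /=; rewrite ?mulr1n ?mulr0n; lra.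
rewrite notin_setE/= => /negP; rewrite -leNgt ler_norml => /andP[h1 h2].
have [|/=] := boolP (z \in below (g + d)); rewrite ?inE ?notin_setE /below /= => h; first lra.
move/negP : h; rewrite -ltNge => h.
have := @smooth_step_right _ n B g d z B0 d0.
have -> : g + d <= z <= g + B by apply/andP; split; lra.
by move=> /(_ isT); lra.
Qed.

Lemma mean_indic_le (E : (R -> R) -> R) n (B g d : R) : is_mean E ->
  0 < B -> 0 <= d -> d <= 4 * B ->
  E \1_(below (g - d)) <= E (smooth_step n B g) + (1 - d / (4 * B)) ^+ n + E \1_(far g B).
Proof.
move=> hE B0 d0 dB.
have ms := bounded_measurable_trigpoly (trigpoly_smooth_step n B g).
have mf := bounded_measurable_indic (measurable_far g B).
rewrite -meanDcst// -meanD//; last exact: bounded_measurableD ms (bounded_measurable_cst _).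
apply: mean_le => // [||z]; last exact: le_smooth_step.
- exact: bounded_measurable_indic (measurable_below _).
- by do 2?apply: bounded_measurableD => //; exact: bounded_measurable_cst.
Qed.

Lemma mean_indic_ge (E : (R -> R) -> R) n (B g d : R) : is_mean E ->
  0 < B -> 0 <= d -> d <= 4 * B ->
  E (smooth_step n B g) <= E \1_(below (g + d)) + (1 - d / (4 * B)) ^+ n + E \1_(far g B).
Proof.
move=> hE B0 d0 dB.
have ms := bounded_measurable_trigpoly (trigpoly_smooth_step n B g).
have mf := bounded_measurable_indic (measurable_far g B).
have mb := bounded_measurable_indic (measurable_below (g + d)).
rewrite -meanDcst// -meanD//; last exact: bounded_measurableD mb (bounded_measurable_cst _).
apply: mean_le => // [|z]; last exact: ge_smooth_step.
by do 2?apply: bounded_measurableD => //; exact: bounded_measurable_cst.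
Qed.

Section Limit.
Variables (T : Type) (F : set_system T) (FF : Filter F).
Variables (E : T -> (R -> R) -> R) (G : (R -> R) -> R).
Hypothesis hE : \forall x \near F, is_mean (E x).
Hypothesis hG : is_mean G.
Hypothesis cvg_cos : forall t a,
  E x (fun z => cos (t * z + a)) @[x --> F] --> G (fun z => cos (t * z + a)).
Hypothesis tight : forall (c e : R), 0 < e -> exists B0 : R, forall B, B0 <= B ->
  (\forall x \near F, E x \1_(far c B) <= e) /\ G \1_(far c B) <= e.

Lemma cvg_trigpoly g : trigpoly g -> E x g @[x --> F] --> G g.
Proof.
elim=> {g} [t a|g h tg IHg th IHh|c g tg IH]; first exact: cvg_cos.
- have mg := bounded_measurable_trigpoly tg; have mh := bounded_measurable_trigpoly th.
  rewrite meanD//.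
  apply: cvg_trans (cvgD IHg IHh); apply: near_eq_cvg.
  by apply: filterS hE => x hx; rewrite meanD.
- have mg := bounded_measurable_trigpoly tg.
  rewrite meanZ//.
  apply: cvg_trans (cvgM (cvg_cst c) IH); apply: near_eq_cvg.
  by apply: filterS hE => x hx; rewrite meanZ.
Qed.

(** The smooth steps are centred at the midpoints c - d/2 and c + d/2, so that each transition takes
    place on one side of [c]. The order of choices is: [B] from tightness at both centres, then [n],
    then [x]. On each side there are two tail errors and two step errors of at most e/6, and one
    cosine error below e/5, which together stay below e. *)
Lemma cvg_below_sandwich (c d e : R) : 0 < d -> 0 < e -> \forall x \near F,
  G \1_(below (c - d)) - e <= E x \1_(below c) <= G \1_(below (c + d)) + e.
Proof.
move=> d0 e0.
have e6 : 0 < e / 6 by rewrite divr_gt0.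
have d2 : 0 < d / 2 by rewrite divr_gt0.
have [B1 hB1] := tight (c - d / 2) e6.
have [B2 hB2] := tight (c + d / 2) e6.
pose B := Num.max (Num.max B1 B2) d.
have [EB1 GB1] : (\forall x \near F, E x \1_(far (c - d / 2) B) <= e / 6) /\
   G \1_(far (c - d / 2) B) <= e / 6 by apply: hB1; rewrite /B !le_max lexx.
have [EB2 GB2] : (\forall x \near F, E x \1_(far (c + d / 2) B) <= e / 6) /\
   G \1_(far (c + d / 2) B) <= e / 6 by apply: hB2; rewrite /B !le_max lexx orbT.
have Bd : d <= B by rewrite le_max lexx orbT.
have B0 : 0 < B by apply: lt_le_trans Bd.
have d4 : d / 2 <= 4 * B by lra.
have [n hn] : exists n, (1 - d / 2 / (4 * B)) ^+ n <= e / 6.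
  have q0 : 0 < d / 2 / (4 * B) by rewrite divr_gt0// mulr_gt0.
  have q1 : d / 2 / (4 * B) <= 1 by rewrite ler_pdivrMr ?mul1r// mulr_gt0.
  have : `|1 - d / 2 / (4 * B)| < 1 by rewrite ltr_norml; apply/andP; split; lra.
  move=> /cvg_expr /cvgrPdist_le /(_ _ e6) [n _ /(_ n (leqnn n))] /=.
  by rewrite sub0r normrN => h; exists n; exact: le_trans (ler_norm _) h.
have close g : \forall x \near F, `|G (smooth_step n B g) - E x (smooth_step n B g)| <= e / 6.
  by have /cvgrPdist_le/(_ _ e6) := cvg_trigpoly (trigpoly_smooth_step n B g).
have c1 := close (c - d / 2); have c2 := close (c + d / 2).
near=> x.
have hx : is_mean (E x) by near: x.
have Ex1 : E x \1_(far (c - d / 2) B) <= e / 6 by near: x.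
have Ex2 : E x \1_(far (c + d / 2) B) <= e / 6 by near: x.
have /ltr_normlP x1 : `|G (smooth_step n B (c - d / 2)) - E x (smooth_step n B (c - d / 2))| < e / 5.
  by apply: (@le_lt_trans _ _ (e / 6)); [near: x|lra].
have /ltr_normlP x2 : `|G (smooth_step n B (c + d / 2)) - E x (smooth_step n B (c + d / 2))| < e / 5.
  by apply: (@le_lt_trans _ _ (e / 6)); [near: x|lra].
case: x1 => x11 x12; case: x2 => x21 x22.
have d20 := ltW d2.
apply/andP; split.
- have h1 := @mean_indic_le _ n B (c - d / 2) _ hG B0 d20 d4.
  have h2 := @mean_indic_ge _ n B (c - d / 2) _ hx B0 d20 d4.
  rewrite subrK in h2.
  have cd : c - d / 2 - d / 2 = c - d by field.
  rewrite cd in h1; lra.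
- have h1 := @mean_indic_ge _ n B (c + d / 2) _ hG B0 d20 d4.
  have h2 := @mean_indic_le _ n B (c + d / 2) _ hx B0 d20 d4.
  rewrite addrK in h2.
  have cd : c + d / 2 + d / 2 = c + d by field.
  rewrite cd in h1; lra.
Unshelve. all: by end_near. Qed.

End Limit.
End Comparison.

(** * Sums of independent Bernoulli variables *)

Section BernoulliModel.
Context {R : realType} {T : eqType}.
Variable lam : T -> R.

(* Expectation of F(D) for the random sublist D of s keeping each l in s
   independently with probability [lam l]. *)
Fixpoint bern (s : seq T) (F : seq T -> R) : R :=
  if s is l :: s' then (1 - lam l) * bern s' F + lam l * bern s' (fun D => F (l :: D))
  else F [::].

Lemma eq_bern s F G : (forall D, subseq D s -> F D = G D) -> bern s F = bern s G.
Proof.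
elim: s F G => [|l s IH] F G FG /=; first by rewrite FG.
congr (_ * _ + _ * _); apply: IH => D Ds; apply: FG.
  by rewrite (subseq_trans Ds)// subseq_cons.
by rewrite /= eqxx.
Qed.

Lemma bernD s F G : bern s (fun D => F D + G D) = bern s F + bern s G.
Proof. by elim: s F G => //= l s IH F G; rewrite !IH; ring. Qed.

Lemma bernZ s c F : bern s (fun D => c * F D) = c * bern s F.
Proof. by elim: s F => //= l s IH F; rewrite !IH; ring. Qed.

Lemma bern_cst s c : bern s (fun=> c) = c.
Proof. by elim: s => //= l s ->; ring. Qed.

Lemma bern_sum (I : Type) (r : seq I) s (F : I -> seq T -> R) :
  bern s (fun D => \sum_(i <- r) F i D) = \sum_(i <- r) bern s (F i).
Proof.
elim: r => [|i r IH].
  by under [in LHS]eq_bern do rewrite big_nil; rewrite bern_cst big_nil.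
by rewrite big_cons -IH -bernD; apply: eq_bern => D _; rewrite big_cons.
Qed.

Lemma ler_bern s F G : (forall l, l \in s -> 0 <= lam l <= 1) ->
  (forall D, F D <= G D) -> bern s F <= bern s G.
Proof.
elim: s F G => [|l s IH] F G lam01 FG //=.
have /andP[l0 l1] := lam01 l (mem_head _ _).
have lam01' l' : l' \in s -> 0 <= lam l' <= 1 by move=> h; rewrite lam01// inE h orbT.
by apply: lerD; apply: ler_wpM2l; rewrite ?subr_ge0//; apply: IH.
Qed.

Lemma bern_subset s t : uniq s -> uniq t -> {subset t <= s} ->
  bern s (fun D => (all (mem D) t)%:R) = \prod_(l <- t) lam l.
Proof.
(* The induction peels a letter off [r] while [t] may still contain it, so the value 0 for words not
   contained in [r] must be part of the claim. *)
have gen (r : seq T) : uniq r -> forall t, uniq t ->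
    bern r (fun D => (all (mem D) t)%:R) = if all (mem r) t then \prod_(l <- t) lam l else 0.
  elim: r => [|l r IH] /= => [_ {}t _|/andP[lr ur] {}t ut].
    case: t => [|x t] /=; first by rewrite big_nil.
    by [].
  have -> : bern r (fun D => (all (mem (l :: D)) t)%:R) =
            bern r (fun D => (all (mem D) (rem l t))%:R).
    apply: eq_bern => D /mem_subseq Dr; congr (_%:R); congr nat_of_bool.
    rewrite rem_filter//; apply/allP/allP => /= h x.
      by rewrite mem_filter/= => /andP[xl /h]; rewrite inE (negPf xl).
    move=> xt; rewrite inE; have [//|xl] := eqVneq x l.
    by apply: h; rewrite mem_filter xt andbT /= xl.
  rewrite IH// IH ?rem_uniq//.
  have [lt|lt] := boolP (l \in t).
    have -> : all (mem r) t = false.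
      by apply/negP => /allP/(_ _ lt); rewrite inE (negPf lr).
    have -> : all (mem (l :: r)) t = all (mem r) (rem l t).
      rewrite rem_filter//; apply/allP/allP => /= h x.
        by rewrite mem_filter/= => /andP[xl /h]; rewrite inE (negPf xl).
      move=> xt; rewrite inE; have [//|xl] := eqVneq x l.
      by apply: h; rewrite mem_filter xt andbT /= xl.
    rewrite mulr0 add0r; case: ifP => _; last by rewrite mulr0.
    by rewrite (perm_big _ (perm_to_rem lt)) big_cons.
  have -> : all (mem (l :: r)) t = all (mem r) t.
    apply/allP/allP => /= h x xt; have := h x xt; rewrite !inE; last by move=> ->; rewrite orbT.
    by case: eqVneq => // xl; rewrite xl (negPf lt) in xt.
  by rewrite rem_id//; case: ifP => _; ring.
move=> us ut ts; rewrite gen//; case: ifP => // /negP[]; exact/allP.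
Qed.

(** By independence the mean is the product of the factors 1 + lam l (e^c - 1), each at most exp(lam
    l (e^c - 1)). *)
Lemma bern_exp s (c : R) : (forall l, l \in s -> 0 <= lam l <= 1) ->
  bern s (fun D => expR (c * (size D)%:R)) <= expR ((\sum_(l <- s) lam l) * (expR c - 1)).
Proof.
elim: s => [|l s IH] lam01 /=; first by rewrite big_nil mulr0 mul0r.
have /andP[l0 l1] := lam01 l (mem_head _ _).
have lam01' l' : l' \in s -> 0 <= lam l' <= 1 by move=> h; rewrite lam01// inE h orbT.
have -> : bern s (fun D => expR (c * (size D).+1%:R)) =
    expR c * bern s (fun D => expR (c * (size D)%:R)).
  rewrite -bernZ; apply: eq_bern => D _; rewrite -expRD -natr1; congr expR; ring.
rewrite big_cons (mulrDl (lam l)) expRD mulrA -mulrDl.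
apply: ler_pM; rewrite ?IH//.
- by rewrite addr_ge0 ?mulr_ge0 ?expR_ge0 ?subr_ge0.
- rewrite -[leLHS](bern_cst s 0); apply: ler_bern => // D; exact: expR_ge0.
- apply: le_trans (expR_ge1Dx _); lra.
Qed.

End BernoulliModel.

(** * Falling factorials as counts of words without repetition *)

Section InjectiveTuples.
Context {T : eqType}.

Fixpoint uniq_words (u : nat) (s : seq T) : seq (seq T) :=
  if u is u'.+1 then [seq l :: t | t <- uniq_words u' s, l <- [seq l <- s | l \notin t]]
  else [:: [::]].

Lemma mem_uniq_words u s t :
  (t \in uniq_words u s) = [&& size t == u, uniq t & all (mem s) t].
Proof.
elim: u t => [|u IH] t; first by case: t.
apply/allpairsPdep/idP => [[t' [l [t'u]]]|].
  rewrite mem_filter => /andP[lt' ls] -> /=; move: t'u; rewrite IH => /and3P[/eqP -> -> ->].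
  by rewrite lt' eqxx ls.
case: t => // l t /= /and3P[st /andP[lt ut] /andP[ls ts]].
exists t, l; split => //; first by rewrite IH -eqSS st ut ts.
by rewrite mem_filter lt.
Qed.

Lemma uniq_uniq_words u s : uniq s -> uniq (uniq_words u s).
Proof.
move=> us; elim: u => //= u IH; apply: allpairs_uniq_dep => //.
  by move=> t _; rewrite filter_uniq.
by move=> [t l] [t' l'] /= _ _ [-> ->].
Qed.

(** A word of [u] distinct letters of [D] extends by a new letter of [D] in size D - u ways, which
    is the recursion of the falling factorial. This identity turns factorial moments into the sums
    over distinct primes of hypothesis (f). *)
Lemma sum_uniq_words (R : realType) u (s D : seq T) : uniq s -> uniq D -> {subset D <= s} ->
  \sum_(t <- uniq_words u s) (all (mem D) t)%:R = (size D ^_ u)%:R :> R.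
Proof.
move=> us uD Ds; elim: u => [|u IH]; first by rewrite /= big_seq1.
rewrite /= big_allpairs_dep ffactnSr natrM -IH big_distrl /=.
rewrite !big_seq; apply: eq_bigr => t; rewrite mem_uniq_words => /and3P[/eqP st ut ts].
case tD : (all (mem D) t); last first.
  by rewrite mul0r big1// => l _; rewrite /= andbF.
rewrite mul1r; under eq_bigr do rewrite /= andbT.
rewrite -natr_sum; congr (_%:R).
have -> : (\sum_(i <- [seq l <- s | l \notin t]) (i \in D) =
           count (mem D) [seq l <- s | l \notin t])%N.
  by rewrite -sum1_count [RHS]big_mkcond; apply: eq_bigr => i _ /=; case: (i \in D).
rewrite -size_filter -filter_predI.
have -> : size [seq x <- s | predI (mem D) (fun l => l \notin t) x] =
          count (predC (mem t)) D.
  rewrite -size_filter; apply: perm_size; apply: uniq_perm; rewrite ?filter_uniq// => x.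
  rewrite !mem_filter /=; apply/andP/andP => -[]; first by case/andP=> -> -> _.
  by move=> -> xD; rewrite xD Ds.
have <- : count (mem t) D = u.
  rewrite -st -size_filter; apply: perm_size; apply: uniq_perm; rewrite ?filter_uniq// => x.
  by rewrite mem_filter /=; apply/andP/idP => [[]//|xt]; split => //; exact: (allP tD).
by rewrite -(count_predC (mem t) D) addKn.
Qed.
End InjectiveTuples.

(** * The Gaussian law *)

Section Gauss.
Context {R : realType}.
Local Notation mu := (@lebesgue_measure R).
Local Notation phi := (normal_pdf (0 : R) 1).

Definition gauss_mean (g : R -> R) : R := (\int[mu]_u (g u * phi u))%R.

Lemma phiE (u : R) : phi u = (Num.sqrt (2 * pi))^-1 * expR (- (u ^+ 2 / 2)).
Proof.
rewrite normal_pdfE ?oner_neq0// /normal_peak /normal_fun subr0 expr1n mul1r mulr_natl.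
by congr (_ * expR _); rewrite mulNr.
Qed.

Lemma integrable_gauss (g : R -> R) : bounded_measurable g ->
  mu.-integrable setT (EFin \o (fun u => g u * phi u)).
Proof.
move=> [mg [M gM]].
apply: (le_integrable measurableT _ _ (integrableZl measurableT M (integrable_normal_pdf 0 1))).
  apply/measurable_EFinP; apply: measurable_funM => //; exact: measurable_normal_pdf.
move=> u _ /=; rewrite lee_fin normrM [leRHS]normrM ler_wpM2r//.
exact: le_trans (ler_norm _).
Qed.

Lemma gauss_mean_is_mean : is_mean gauss_mean.
Proof.
split.
- rewrite /gauss_mean; under eq_Rintegral do rewrite mul1r.
  by rewrite /Rintegral integral_normal_pdf.
- move=> g h mg mh; rewrite /gauss_mean -RintegralD//; [|exact: integrable_gauss..].
  by apply: eq_Rintegral => u _; rewrite mulrDl.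
- move=> c g mg; rewrite /gauss_mean -RintegralZl//; last exact: integrable_gauss.
  by apply: eq_Rintegral => u _; rewrite mulrA.
- move=> g h mg mh gh; apply: le_Rintegral => //; [exact: integrable_gauss..|].
  by move=> u _; rewrite ler_wpM2r// normal_pdf_ge0.
Qed.


Local Notation bell := (fun u : R => expR (- (u ^+ 2 / 2))).

Lemma integrable_bell : mu.-integrable setT (EFin \o bell).
Proof.
have := integrableZl measurableT (Num.sqrt (2 * pi)) (integrable_normal_pdf (0 : R) 1).
apply: eq_integrable => // u _ /=; rewrite phiE -EFinM mulrA divff ?mul1r//.
by rewrite gt_eqF// sqrtr_gt0 mulr_gt0// pi_gt0.
Qed.

Lemma gauss_mean_below (c : R) : gauss_mean \1_(below c) = Phi c.
Proof.
rewrite /gauss_mean /Phi -RintegralZl//; last first.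
  by apply: integrableS integrable_bell.
rewrite [RHS]Rintegral_mkcond.
have -> : [set` `]-oo, c]] = below c by apply/seteqP; split => z; rewrite /= in_itv.
apply: eq_Rintegral => u _.
rewrite patchE indicE phiE; case: (u \in _); first by rewrite mul1r.
by rewrite mul0r.
Qed.

Lemma continuous_is_derive (F f : R -> R) :
  (forall u : R, is_derive u 1 F (f u)) -> continuous F.
Proof.
move=> Fd u; apply/differentiable_continuous/derivable1_diffP.
exact: (@ex_derive _ _ _ _ _ _ _ (Fd u)).
Qed.

Lemma is_derive_bell (u : R) : is_derive u 1 bell (- u * bell u).
Proof.
have hd : is_derive u 1 (fun u : R => - (u ^+ 2 / 2)) (- u).
  have -> : (fun u : R => - (u ^+ 2 / 2)) = (fun u : R => (- (1 / 2)) *: (u ^+ 2)).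
    by apply/funext => z; rewrite /GRing.scale/=; field.
  have -> : - u = - (1 / 2) *: (2 *: (u *: 1)) :> R by rewrite /GRing.scale/=; field.
  by apply: is_deriveZ; apply: is_derive_eq; rewrite /GRing.scale/=; ring.
apply: is_derive_eq (@is_derive1_comp _ expR _ u _ _ (is_derive_expR _) hd) _.
by rewrite mulrC.
Qed.

Lemma continuous_bell : continuous bell.
Proof.
exact: continuous_is_derive is_derive_bell.
Qed.

(** Half of the exponent absorbs |u|, by |u| <= 2 (1 + u^2/4) <= 2 e^{u^2/4}. What remains is a
    multiple of the normal density of variance 2, hence integrable. *)
Lemma bell_decay (u : R) : `|u| * bell u <= 2 * expR (- (u ^+ 2 / 4)).
Proof.
have -> : - (u ^+ 2 / 2) = - (u ^+ 2 / 4) + - (u ^+ 2 / 4) by field.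
rewrite expRD mulrA ler_wpM2r ?expR_ge0//.
rewrite expRN ler_pdivrMr ?expR_gt0//.
have h := expR_ge1Dx (u ^+ 2 / 4).
have : `|u| ^+ 2 = u ^+ 2 by rewrite real_normK ?num_real.
have := normr_ge0 u; move: `|u| => v v0 vu; nra.
Qed.

Lemma integrable_bell4 : mu.-integrable setT (EFin \o (fun u : R => 2 * expR (- (u ^+ 2 / 4)))).
Proof.
have s2 : Num.sqrt 2 != 0 :> R by rewrite sqrtr_eq0 -ltNge.
have := integrableZl measurableT (2 / normal_peak (Num.sqrt 2))
  (integrable_normal_pdf (0 : R) (Num.sqrt 2)).
apply: eq_integrable => // u _ /=; rewrite normal_pdfE// /normal_fun subr0 -EFinM.
congr (_%:E).
rewrite mulrA mulfVK ?gt_eqF ?normal_peak_gt0// sqr_sqrtr//.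
congr (_ * expR _); rewrite -mulr_natl mulNr; congr (- _); by field.
Qed.

Lemma integrable_linear_bell (g : R -> R) (C : R) : measurable_fun setT g ->
  (forall u, `|g u| <= C * `|u| * bell u) -> mu.-integrable setT (EFin \o g).
Proof.
move=> mg gb.
apply: (le_integrable measurableT _ _ (integrableZl measurableT C integrable_bell4)).
  exact/measurable_EFinP.
move=> u _ /=; rewrite lee_fin (le_trans (gb u))// (le_trans _ (ler_norm _))//.
have C0 : 0 <= C.
  have := gb 1; rewrite normr1 mulr1 => /(le_trans (normr_ge0 _)).
  by rewrite pmulr_lge0 ?expR_gt0.
by rewrite -mulrA ler_wpM2l// bell_decay.
Qed.

(** Dominated convergence for the truncations of [f] to [-n, n], whose integrals are F(n) -
    F(-n). *)
Lemma improper_FTC (F f : R -> R) : (forall u : R, is_derive u 1 F (f u)) ->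
  continuous f -> mu.-integrable setT (EFin \o f) ->
  F n%:R @[n --> \oo] --> (0 : R) -> F (- n%:R) @[n --> \oo] --> (0 : R) ->
  (\int[mu]_u f u)%R = 0.
Proof.
move=> Fd cf intf F1 F2.
have cF : continuous F by exact: continuous_is_derive Fd.
pose g (n : nat) (u : R) := ((f \_ `[- n%:R, n%:R]) u)%:E.
have h : (\int[mu]_u g n u)%E @[n --> \oo] --> (\int[mu]_u (f u)%:E)%E.
  apply: (@dominated_cvg _ _ _ mu setT measurableT g (EFin \o f) (fun u => `|f u|%:E)).
  - move=> n; apply/measurable_EFinP.
    apply/(measurable_restrictT _ _).1 => //.
    by apply: measurable_funS (continuous_measurable_fun cf).
  - move=> u _; apply: cvg_near_cst.
    have [n0 hn0] : exists n0 : nat, `|u| <= n0%:R.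
      by exists (Num.trunc `|u|).+1; rewrite ltW// truncnS_gt.
    exists n0 => // n /= n0n; rewrite /g patchE ifT// inE/= in_itv/= -ler_norml.
    by rewrite (le_trans hn0)// ler_nat.
  - by [].
  - by have := integrable_abse intf.
  - move=> n u _; rewrite /g lee_fin patchE; case: ifP => // _.
    by rewrite normr0.
(* The index is shifted by one because the fundamental theorem of calculus is applied to a
   nondegenerate interval. *)
have e n : (\int[mu]_u g n.+1 u)%E = (F n.+1%:R - F (- n.+1%:R))%:E.
  rewrite [LHS](_ : _ = (\int[mu]_(u in `[(- n.+1%:R)%R, (n.+1%:R)%R]) (f u)%:E)%E); last first.
    rewrite [RHS]integral_mkcond; apply: eq_integral => u _.
    by rewrite /g /patch; case: ifP.
  rewrite EFinB; apply: continuous_FTC2.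
  - by rewrite gtrN.
  - by apply: continuous_subspaceT => z; exact: cf.
  - split=> [u _||].
    + exact: (@ex_derive _ _ _ _ _ _ _ (Fd u)).
    + exact: cvg_at_right_filter (cF _).
    + exact: cvg_at_left_filter (cF _).
  - by move=> u _; rewrite derive1E; exact: (@derive_val _ _ _ _ _ _ _ (Fd u)).
have {h} : (\int[mu]_u g n.+1 u)%E @[n --> \oo] --> (\int[mu]_u (f u)%:E)%E.
  by rewrite (cvg_shiftS (fun n => (\int[mu]_u g n u)%E)).
have : (\int[mu]_u g n.+1 u)%E @[n --> \oo] --> 0%:E.
  under eq_fun do rewrite e.
  apply: cvg_EFin; first exact: nearW.
  rewrite -[X in _ --> X](subr0 (0 : R)).
  by apply: cvgB; [rewrite (cvg_shiftS (fun n => F n%:R))|rewrite (cvg_shiftS (fun n => F (- n%:R)))].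
move=> h1 h2; rewrite /Rintegral.
by have -> : (\int[mu]_u (f u)%:E)%E = 0%:E by exact: cvg_unique h2 h1.
Qed.

End Gauss.

(** * The cosine means of the Gaussian law *)

Section GaussCos.
Context {R : realType}.
Local Notation mu := (@lebesgue_measure R).
Local Notation phi := (normal_pdf (0 : R) 1).
Local Notation bell := (fun u : R => expR (- (u ^+ 2 / 2))).

Lemma is_derive_affine (t a u : R) : is_derive u 1 (fun u => t * u + a) t.
Proof.
have -> : (fun u => t * u + a) = (t \*: (id : R -> R)) + cst a by [].
by apply: is_derive_eq; rewrite addr0 /GRing.scale/= mulr1.
Qed.

Lemma is_derive_cos_affine (t a u : R) :
  is_derive u 1 (fun u => cos (t * u + a)) (- (t * sin (t * u + a))).
Proof.
apply: is_derive_eq (is_derive1_comp (is_derive_cos _) (is_derive_affine t a u)) _.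
by rewrite mulNr mulrC.
Qed.

Lemma is_derive_sin_affine (t a u : R) :
  is_derive u 1 (fun u => sin (t * u + a)) (t * cos (t * u + a)).
Proof.
apply: is_derive_eq (is_derive1_comp (is_derive_sin _) (is_derive_affine t a u)) _.
by rewrite mulrC.
Qed.

Lemma continuous_cos_affine (t a : R) : continuous (fun u : R => cos (t * u + a)).
Proof. exact: continuous_is_derive (is_derive_cos_affine t a). Qed.

Lemma continuous_sin_affine (t a : R) : continuous (fun u : R => sin (t * u + a)).
Proof. exact: continuous_is_derive (is_derive_sin_affine t a). Qed.

Lemma measurable_bell : measurable_fun setT bell.
Proof. by apply: continuous_measurable_fun => z; exact: continuous_bell. Qed.

Lemma integrable_cos_bell (t a : R) :
  mu.-integrable setT (EFin \o (fun u => cos (t * u + a) * bell u)).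
Proof.
apply: (le_integrable measurableT _ _ integrable_bell).
  apply/measurable_EFinP; apply: measurable_funM; last exact: measurable_bell.
  by apply: continuous_measurable_fun => z; exact: continuous_cos_affine.
move=> u _ /=; rewrite lee_fin normrM ler_piMl// cos_max//.
Qed.

Lemma integrable_usin_bell (t a : R) :
  mu.-integrable setT (EFin \o (fun u => u * sin (t * u + a) * bell u)).
Proof.
apply: (@integrable_linear_bell _ _ 1).
  apply: measurable_funM; last exact: measurable_bell.
  apply: measurable_funM => //.
  by apply: continuous_measurable_fun => z; exact: continuous_sin_affine.
move=> u; rewrite mul1r normrM (ger0_norm (expR_ge0 _)) ler_wpM2r ?expR_ge0//.
by rewrite normrM ler_piMr// sin_max.
Qed.

Lemma cvg_bell : bell n%:R @[n --> \oo] --> (0 : R).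
Proof.
apply: (@squeeze_cvgr _ _ _ _ (fun=> 0) (fun n : nat => 2 * n.+1%:R^-1)).
- near=> n; rewrite expR_ge0/= expRN.
  have n1 : (0 < n)%N by near: n; exact: nbhs_infty_gt.
  have n2 : 0 < n.+1%:R :> R by rewrite ltr0n.
  rewrite -div1r ler_pdivrMr ?expR_gt0// mulrAC ler_pdivlMr// mul1r.
  have h1 : 1 + (n%:R : R) ^+ 2 / 2 <= expR ((n%:R : R) ^+ 2 / 2) by exact: expR_ge1Dx.
  have h2 : 0 <= ((n%:R : R) - 1) ^+ 2 by exact: sqr_ge0.
  rewrite -natr1; move: h1 h2; move: (n%:R : R) => v; move: (expR _) => w h1 h2; nra.
- exact: cvg_cst.
- rewrite -[X in _ --> X](mulr0 (2 : R)); apply: cvgM; first exact: cvg_cst.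
  exact: cvg_harmonic.
Unshelve. all: by end_near. Qed.

(** Stein's identity: the derivative of sin(t u + a) e^{-u^2/2}, a function vanishing at both
    infinities, has integral 0. *)
Lemma gauss_stein (t a : R) :
  (\int[mu]_u (u * sin (t * u + a) * bell u))%R = t * (\int[mu]_u (cos (t * u + a) * bell u))%R.
Proof.
have i1 := integrable_cos_bell t a; have i2 := integrable_usin_bell t a.
have i3 : mu.-integrable setT (EFin \o (fun u => t * (cos (t * u + a) * bell u))).
  exact: integrableZl i1.
pose F u := sin (t * u + a) * bell u.
pose f u := t * (cos (t * u + a) * bell u) - u * sin (t * u + a) * bell u.
have : (\int[mu]_u f u)%R = 0.
  apply: (@improper_FTC _ F f).
  - move=> u; apply: is_derive_eq (is_deriveM (is_derive_sin_affine t a u) (is_derive_bell u)) _.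
    rewrite /GRing.scale/= /f; ring.
  - move=> u; apply: cvgB; apply: cvgM.
    + exact: cvg_cst.
    + by apply: cvgM; [exact: continuous_cos_affine|exact: continuous_bell].
    + by apply: cvgM; [exact: cvg_id|exact: continuous_sin_affine].
    + exact: continuous_bell.
  - exact: (integrableB measurableT i3 i2).
  - apply: (@squeeze_cvgr _ _ _ _ (fun n : nat => - bell n%:R) (fun n : nat => bell n%:R)).
    + apply: nearW => n; rewrite -ler_norml /F normrM (ger0_norm (expR_ge0 _)).
      by rewrite ler_piMl ?expR_ge0// sin_max.
    + by rewrite -oppr0; apply: cvgN; exact: cvg_bell.
    + exact: cvg_bell.
  - apply: (@squeeze_cvgr _ _ _ _ (fun n : nat => - bell n%:R) (fun n : nat => bell n%:R)).
    + apply: nearW => n; rewrite -ler_norml /F normrM (ger0_norm (expR_ge0 _)) sqrrN.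
      by rewrite ler_piMl ?expR_ge0// sin_max.
    + by rewrite -oppr0; apply: cvgN; exact: cvg_bell.
    + exact: cvg_bell.
rewrite RintegralB// RintegralZl//; by move/eqP; rewrite subr_eq0 => /eqP.
Qed.

(** Differentiation under the integral, dominated by |u| e^{-u^2/2}, produces -u sin(t u + a);
    [gauss_stein] turns it back into the cosine integral and yields the equation I' = -t I. *)
Lemma is_derive_gauss_cos (t a : R) :
  is_derive t 1 (fun t => (\int[mu]_u (cos (t * u + a) * bell u))%R)
    (- t * (\int[mu]_u (cos (t * u + a) * bell u))%R).
Proof.
pose f (s u : R) := cos (s * u + a) * bell u.
have fd (s u : R) : is_derive s 1 (f ^~ u) (- (u * sin (s * u + a)) * bell u).
  have -> : f ^~ u = (fun s => bell u *: cos (u * s + a)).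
    by apply/funext => z; rewrite /f /GRing.scale/= mulrC (mulrC u).
  apply: is_derive_eq (is_deriveZ (bell u) (is_derive_cos_affine u a s)) _.
  rewrite /GRing.scale/= (mulrC s); ring.
have fdE (s u : R) : partial1of2 f s u = - (u * sin (s * u + a)) * bell u.
  by rewrite partial1of2E; exact: (@derive_val _ _ _ _ _ _ _ (fd s u)).
have It : [set` `](t - 1), (t + 1)[] t by rewrite /= in_itv/=; apply/andP; split; lra.
have intf s : [set` `](t - 1), (t + 1)[] s -> mu.-integrable setT (EFin \o f s).
  by move=> _; exact: integrable_cos_bell.
have derf s u : [set` `](t - 1), (t + 1)[] s -> setT u -> derivable (f ^~ u) s 1.
  by move=> _ _; exact: (@ex_derive _ _ _ _ _ _ _ (fd s u)).
pose G (u : R) := `|u| * bell u.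
have G0 u : 0 <= G u by rewrite mulr_ge0 ?expR_ge0.
have intG : mu.-integrable setT (EFin \o G).
  apply: (@integrable_linear_bell _ _ 1).
    by apply: measurable_funM; [exact: normr_measurable|exact: measurable_bell].
  by move=> u; rewrite ger0_norm// mul1r.
have Gub s u : [set` `](t - 1), (t + 1)[] s -> setT u -> `|partial1of2 f s u| <= G u.
  move=> _ _; rewrite fdE normrM (ger0_norm (expR_ge0 _)) ler_wpM2r ?expR_ge0//.
  by rewrite normrN normrM ler_piMr// sin_max.
apply: DeriveDef.
  exact: (derivable_under_integral measurableT It intf derf G0 intG Gub).
rewrite -derive1E (differentiation_under_integral measurableT It intf derf G0 intG Gub).
rewrite mulNr -gauss_stein -mulN1r -RintegralZl//; last exact: integrable_usin_bell.
apply: eq_Rintegral => u _; rewrite fdE; ring.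
Qed.

(** The equation I' = -t I is solved by showing that e^{t^2/2} I(t) has derivative 0. The value I(0)
    comes from the total mass of the normal density. *)
Lemma gauss_mean_cos (t a : R) :
  gauss_mean (fun z => cos (t * z + a)) = expR (- (t ^+ 2 / 2)) * cos a.
Proof.
pose I (t : R) := (\int[mu]_u (cos (t * u + a) * bell u))%R.
pose J (t : R) := expR (t ^+ 2 / 2) * I t.
have Jd (s : R) : is_derive s 1 J 0.
  have hd : is_derive s 1 (fun u : R => u ^+ 2 / 2) s.
    have -> : (fun u : R => u ^+ 2 / 2) = (fun u : R => (1 / 2) *: (u ^+ 2)).
      by apply/funext => z; rewrite /GRing.scale/=; field.
    have h1 : is_derive s 1 (fun u : R => u ^+ 2) (2 * s).
      by apply: is_derive_eq; rewrite /GRing.scale/=; ring.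
    apply: is_derive_eq (is_deriveZ (1 / 2) h1) _.
    by rewrite /GRing.scale/=; field.
  have he := is_derive1_comp (is_derive_expR _) hd.
  apply: is_derive_eq (is_deriveM he (is_derive_gauss_cos s a)) _.
  rewrite /GRing.scale/=; ring.
have J0 : J t = J 0.
  have := @le_norm_MVT R J (fun=> 0) 0 0 t Jd.
  rewrite mul0r normr0 => /(_ (fun=> lexx _)); rewrite normr_le0 subr_eq0.
  by move/eqP.
have I1 : (Num.sqrt (2 * pi))^-1 * I 0 = cos a.
  have := @mean1 R _ gauss_mean_is_mean; rewrite /gauss_mean => e1.
  rewrite /I; under eq_Rintegral do rewrite mul0r add0r.
  rewrite RintegralZl//; last exact: integrable_bell.
  rewrite mulrCA -RintegralZl//; last exact: integrable_bell.
  rewrite -[in RHS](mulr1 (cos a)) -[in RHS]e1; congr (_ * _); apply: eq_Rintegral => u _.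
  by rewrite mul1r phiE.
have Jt : I t = expR (- (t ^+ 2 / 2)) * I 0.
  have : J 0 = I 0 by rewrite /J expr0n/= mul0r expR0 mul1r.
  by rewrite -J0 /J => <-; rewrite mulrA -expRD addNr expR0 mul1r.
rewrite -I1 mulrCA -Jt /gauss_mean /I -RintegralZl//; last exact: integrable_cos_bell.
by apply: eq_Rintegral => u _; rewrite phiE; ring.
Qed.

End GaussCos.

(** * From factorial moments to the central limit theorem *)

Section CosTaylor.
Context {R : realType}.

(** The first [n] terms of the Taylor series at u = 0 of cos(u + a), each differentiation adding
    pi/2 to the phase. *)
Fixpoint cos_taylor (n : nat) (a u : R) : R :=
  if n is n'.+1 then cos_taylor n' a u + cos (a + n'%:R * (pi / 2)) * (u ^+ n' / n'`!%:R) else 0.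

Lemma is_derive_monomial n (u : R) :
  is_derive u 1 (fun u : R => u ^+ n.+1 / n.+1`!%:R) (u ^+ n / n`!%:R).
Proof.
have -> : (fun u : R => u ^+ n.+1 / n.+1`!%:R) = n.+1`!%:R^-1 \*: (fun u : R => u ^+ n.+1).
  by apply/funext => z; rewrite /= /GRing.scale/= mulrC.
have h : is_derive u 1 (fun u : R => u ^+ n.+1) (n.+1%:R * u ^+ n).
  elim: n => [|n IH]; first by rewrite mul1r; exact: is_derive_id.
  have -> : (fun u : R => u ^+ n.+2) = (id : R -> R) * (fun u : R => u ^+ n.+1).
    by apply/funext => z; rewrite exprS.
  apply: is_derive_eq (is_deriveM (is_derive_id _ _) IH) _.
  rewrite /GRing.scale/= mulr1 exprS -[n.+2%:R]natr1; ring.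
apply: is_derive_eq (is_deriveZ _ h) _.
rewrite /GRing.scale/= factS natrM; field.
by rewrite pnatr_eq0 -lt0n fact_gt0 /= nat1r pnatr_eq0.
Qed.

Lemma is_derive_cos_taylor n (a u : R) :
  is_derive u 1 (cos_taylor n.+1 a) (cos_taylor n (a + pi / 2) u).
Proof.
elim: n => [|n IH].
  have -> : cos_taylor 1 a = cst (cos a).
    by apply/funext => z; rewrite /= add0r mul0r addr0 expr0 fact0 divr1 mulr1.
  exact: is_derive_cst.
have h := is_deriveZ (cos (a + n.+1%:R * (pi / 2))) (is_derive_monomial n u).
apply: is_derive_eq (is_deriveD IH h) _.
rewrite /= /GRing.scale/=; congr (_ + cos _ * _).
by rewrite -natr1; ring.
Qed.

Lemma cos_taylor0 n (a : R) : cos_taylor n.+1 a 0 = cos a.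
Proof.
elim: n => [|n /= ->]; first by rewrite /= add0r mul0r addr0 expr0 fact0 divr1 mulr1.
by rewrite expr0n /= mul0r mulr0 addr0.
Qed.

(** Cauchy's mean value theorem compares the remainder with u^(n+1)/(n+1)!. The quotient of the
    derivatives is the same quotient at order [n] with phase a + pi/2, so the induction closes
    without integrals. *)
Lemma cos_taylor_bound n (a u : R) :
  `|cos (u + a) - cos_taylor n a u| <= `|u| ^+ n / n`!%:R.
Proof.
elim: n a u => [|n IH] a u.
  by rewrite subr0 expr0 fact0 divr1 cos_max.
pose f u := cos (u + a) - cos_taylor n.+1 a u.
pose g (u : R) := u ^+ n.+1 / n.+1`!%:R.
pose df u := cos (u + (a + pi / 2)) - cos_taylor n (a + pi / 2) u.
pose dg (u : R) := u ^+ n / n`!%:R.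
have fd (v : R) : is_derive v 1 f (df v).
  have h := is_derive_cos_affine 1 a v.
  have -> : df v = - (1 * sin (1 * v + a)) - cos_taylor n (a + pi / 2) v.
    by rewrite /df addrA cosDpihalf !mul1r.
  have -> : f = (fun v => cos (1 * v + a)) - cos_taylor n.+1 a.
    by apply/funext => z; rewrite /f -[X in cos (X + a)]mul1r.
  exact: is_deriveB h (is_derive_cos_taylor n a v).
have gd (v : R) : is_derive v 1 g (dg v) by exact: is_derive_monomial.
have f0 : f 0 = 0 by rewrite /f cos_taylor0 add0r subrr.
have g0 : g 0 = 0 by rewrite /g expr0n mul0r.
have cf A : {within A, continuous f}.
  by apply: continuous_subspaceT => z; exact: continuous_is_derive fd z.
have cg A : {within A, continuous g}.
  by apply: continuous_subspaceT => z; exact: continuous_is_derive gd z.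
have gn v : `|g v| = `|v| ^+ n.+1 / n.+1`!%:R by rewrite /g normrM normrX normfV normr_nat.
have nz (v : R) m : v != 0 -> v ^+ m / m`!%:R != 0.
  by move=> v0; rewrite mulf_neq0 ?expf_neq0// invr_eq0 pnatr_eq0 -lt0n fact_gt0.
have key c : df c / dg c = f u / g u -> u != 0 -> c != 0 -> `|f u| <= `|g u|.
  move=> e u0 c0.
  have -> : f u = f u / g u * g u by rewrite mulfVK// nz.
  rewrite -e normrM ler_piMl// normrM normfV ler_pdivrMr ?normr_gt0 ?nz// mul1r.
  by apply: le_trans (IH _ _) _; rewrite /dg normrM normrX normfV normr_nat.
rewrite -gn -/(f u).
have [->|u0] := eqVneq u 0; first by rewrite f0 normr0.
have [ul|ug] : u < 0 \/ 0 < u by apply/orP; rewrite -neq_lt.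
- have dgn c : c \in `]u, 0[ -> dg c != 0.
    rewrite in_itv/= => /andP[_ c0].
    by rewrite nz// lt_eqF.
  have [c cin e] := cauchy_MVT ul (cf _) (cg _) (fun x _ => fd x) (fun x _ => gd x) dgn.
  apply: (key c) => //; first by rewrite e f0 g0 !sub0r invrN mulrNN.
  by move: cin; rewrite in_itv/= => /andP[_ c0]; rewrite lt_eqF.
- have dgn c : c \in `]0, u[ -> dg c != 0.
    rewrite in_itv/= => /andP[c0 _].
    by rewrite nz// gt_eqF.
  have [c cin e] := cauchy_MVT ug (cf _) (cg _) (fun x _ => fd x) (fun x _ => gd x) dgn.
  apply: (key c) => //; first by rewrite e f0 g0 !subr0.
  by move: cin; rewrite in_itv/= => /andP[c0 _]; rewrite gt_eqF.
Qed.

End CosTaylor.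

(** * Cosine means of a Bernoulli sum by comparison with a Poisson law *)

Section BernoulliCos.
Context {R : realType}.

Lemma le_norm_MVT_itv (f df : R -> R) (M b : R) : 0 <= b ->
  (forall x : R, is_derive x 1 f (df x)) -> (forall x, 0 <= x <= b -> `|df x| <= M) ->
  `|f b - f 0| <= M * b.
Proof.
move=> b0 fd dM.
have [c] := @MVT_segment R f df 0 b b0 (fun v _ => fd v)
   (continuous_subspaceT (continuous_is_derive fd)).
rewrite in_itv/= subr0 => cb ->.
by rewrite normrM (ger0_norm b0) ler_wpM2r// dM.
Qed.

Lemma one_sub_cos_le (s : R) : 0 <= 1 - cos s <= `|s|.
Proof.
rewrite subr_ge0 cos_le1/=.
have := @le_norm_MVT R cos (fun x => - sin x) 1 s 0 (fun z => is_derive_cos z).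
rewrite cos0 sub0r normrN mul1r => h.
by apply: le_trans (ler_norm _) (h _) => x; rewrite normrN sin_max.
Qed.

(* Second-order comparison of e^{l (e^{is} - 1)} with 1 + l (e^{is} - 1),
   multiplied by e^{ia}, in real parts. *)
Lemma cos_poisson_step (l s a : R) : 0 <= l ->
  `|(1 - l) * cos a + l * cos (a + s)
    - expR (- (l * (1 - cos s))) * cos (a + l * sin s)| <= 4 * s ^+ 2 * l ^+ 2.
Proof.
move=> l0; have /andP[c0 cs] := one_sub_cos_le s.
set c := 1 - cos s in c0 cs *; set d := sin s.
have ds : `|d| <= `|s| := le_norm_sin s.
pose e (x : R) := expR (- (x * c)).
have ed (x : R) : is_derive x 1 e (- c * e x).
  have hd : is_derive x 1 (fun x : R => - (x * c)) (- c).
    have -> : (fun x : R => - (x * c)) = (- c) \*: (id : R -> R).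
      by apply/funext => z; rewrite /= /GRing.scale/= mulNr mulrC.
    by apply: is_derive_eq; rewrite /GRing.scale/= mulr1.
  by apply: is_derive_eq (is_derive1_comp (is_derive_expR _) hd) _; rewrite mulrC.
(* [phi] is the real part of exp(x (e^{is} - 1) + ia), with e^{is} - 1 = -c + id, and [psi] is its
   derivative. The expression (1 - l) cos a + l cos(a + s) equals phi(0) + l psi(0), so the claim is
   a first-order Taylor estimate; the second derivative is at most 4 s^2. *)
pose phi x := e x * cos (d * x + a).
pose psi x := - c * phi x - d * (e x * sin (d * x + a)).
have phid (x : R) : is_derive x 1 phi (psi x).
  apply: is_derive_eq (is_deriveM (ed x) (is_derive_cos_affine d a x)) _.
  rewrite /GRing.scale/= /psi /phi; ring.
have psid (x : R) : is_derive x 1 psi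
   (- c * psi x - d * (- c * (e x * sin (d * x + a)) + d * phi x)).
  have h := is_deriveM (ed x) (is_derive_sin_affine d a x).
  apply: is_derive_eq (is_deriveB (is_deriveZ (- c) (phid x)) (is_deriveZ d h)) _.
  rewrite /GRing.scale/= /phi; ring.
have e1 x : 0 <= x -> 0 <= e x <= 1.
  by move=> x0; rewrite expR_ge0 -expR0 ler_expR oppr_le0 mulr_ge0.
have b1 x (g : R) : 0 <= x -> `|g| <= 1 -> `|e x * g| <= 1.
  move=> /e1 /andP[e0 e1x] g1; rewrite normrM (ger0_norm e0).
  by rewrite -[1]mulr1 ler_pM.
have cs' : `|c| <= `|s| by rewrite ger0_norm.
have s0 := normr_ge0 s.
have psib x : 0 <= x <= l -> `|psi x - psi 0| <= 4 * s ^+ 2 * l.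
  move=> /andP[x0 xl].
  have : `|psi x - psi 0| <= 4 * s ^+ 2 * x.
    apply: (le_norm_MVT_itv x0 psid) => z /andP[z0 _].
    have p1 : `|phi z| <= 1 by apply: b1 => //; exact: cos_max.
    have p2 : `|e z * sin (d * z + a)| <= 1 by apply: b1 => //; exact: sin_max.
    have p3 : `|psi z| <= 2 * `|s|.
      rewrite /psi (le_trans (ler_normB _ _))// mulr_natl mulr2n lerD//.
        by rewrite normrM normrN -[leRHS]mulr1 ler_pM.
      by rewrite normrM -[leRHS]mulr1 ler_pM.
    have -> : 4 * s ^+ 2 = `|s| * (2 * `|s|) + `|s| * (2 * `|s|).
      rewrite -(real_normK (num_real s)); ring.
    rewrite (le_trans (ler_normB _ _))// lerD//.
      by rewrite normrM normrN ler_pM.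
    rewrite normrM ler_pM// (le_trans (ler_normD _ _))// mulr_natl mulr2n lerD//.
      by rewrite normrM normrN -[leRHS]mulr1 ler_pM.
    by rewrite normrM -[leRHS]mulr1 ler_pM.
  by move=> /le_trans; apply; rewrite ler_wpM2l// mulr_ge0// sqr_ge0.
pose h x := phi x - x * psi 0.
have hd (x : R) : is_derive x 1 h (psi x - psi 0).
  have h1 : is_derive x 1 (fun x : R => x * psi 0) (psi 0).
    have -> : (fun x : R => x * psi 0) = psi 0 \*: (id : R -> R).
      by apply/funext => z; rewrite /= /GRing.scale/= mulrC.
    by apply: is_derive_eq; rewrite /GRing.scale/= mulr1.
  exact: is_deriveB (phid x) h1.
have := le_norm_MVT_itv l0 hd psib.
rewrite /h mul0r subr0 -mulrA -expr2; apply: le_trans; rewrite distrC le_eqVlt; apply/orP; left.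
apply/eqP; congr (`|_|).
rewrite /psi /phi /e !(mulr0, mul0r, oppr0, expR0, mul1r, add0r).
rewrite (cosD a s) (mulrC d l) (addrC (l * d) a) -/d.
rewrite /c /d; ring.
Qed.

(** One Bernoulli factor is replaced at a time. The phase [a] is generalized because keeping an
    element shifts it by [c]. The errors simply add, as the weights 1 - lam l and lam l sum to 1 and
    the Poisson modulus is at most 1. *)
Lemma bern_cos {T : eqType} (lam : T -> R) (c a : R) s :
  (forall l, l \in s -> 0 <= lam l <= 1) ->
  `|bern lam s (fun D => cos (a + c * (size D)%:R))
    - expR (- ((\sum_(l <- s) lam l) * (1 - cos c))) * cos (a + (\sum_(l <- s) lam l) * sin c)|
  <= 4 * c ^+ 2 * \sum_(l <- s) lam l ^+ 2.
Proof.
elim: s a => [|l s IH] a lam01 /=.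
  by rewrite !big_nil !mul0r oppr0 expR0 !mulr0 addr0 mul1r subrr normr0.
have /andP[l0 l1] := lam01 l (mem_head _ _).
have lam01' l' : l' \in s -> 0 <= lam l' <= 1 by move=> h; rewrite lam01// inE h orbT.
have -> : bern lam s (fun D => cos (a + c * (size D).+1%:R)) =
          bern lam s (fun D => cos ((a + c) + c * (size D)%:R)).
  by apply: eq_bern => D _; congr cos; rewrite -natr1; ring.
rewrite !big_cons.
set L := \sum_(i <- s) lam i; set L2 := \sum_(i <- s) lam i ^+ 2.
have := IH (a + c) lam01'; have := IH a lam01'; rewrite -/L -/L2 => h1 h2.
have h3 := cos_poisson_step c (a + L * sin c) l0.
set X := bern _ _ _ in h1 *; set Y := bern _ _ _ in h2 *.
set E := expR (- (L * (1 - cos c))) in h1 h2.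
have E01 : 0 <= E <= 1.
  have L0 : 0 <= L by rewrite /L big_seq sumr_ge0// => i /lam01' /andP[].
  have /andP[c0 _] := one_sub_cos_le c.
  by rewrite expR_ge0 -expR0 ler_expR oppr_le0 mulr_ge0.
have -> : expR (- ((lam l + L) * (1 - cos c))) = E * expR (- (lam l * (1 - cos c))).
  by rewrite -expRD; congr expR; ring.
have -> : a + (lam l + L) * sin c = a + L * sin c + lam l * sin c by ring.
have e2 : a + c + L * sin c = a + L * sin c + c by ring.
rewrite e2 in h2.
move: h3 h1 h2; set Z := expR _ * _; set C1 := cos _; set C2 := cos _ => h3 h1 h2.
have -> : (1 - lam l) * X + lam l * Y - E * expR (- (lam l * (1 - cos c))) *
    cos (a + L * sin c + lam l * sin c) =
  (1 - lam l) * (X - E * C1) + lam l * (Y - E * C2) + E * ((1 - lam l) * C1 + lam l * C2 - Z).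
  by rewrite /Z; ring.
have -> : 4 * c ^+ 2 * (lam l ^+ 2 + L2) = (1 - lam l) * (4 * c ^+ 2 * L2) +
   lam l * (4 * c ^+ 2 * L2) + 4 * c ^+ 2 * lam l ^+ 2 by ring.
apply: le_trans (ler_normD _ _) _; apply: lerD.
  apply: le_trans (ler_normD _ _) _; rewrite !normrM (ger0_norm l0) ger0_norm ?subr_ge0//.
  by apply: lerD; apply: ler_wpM2l => //; rewrite subr_ge0.
case/andP: E01 => E0 E1; rewrite normrM (ger0_norm E0) (le_trans _ h3)//.
by rewrite ler_piMl.
Qed.

End BernoulliCos.

Section CountMean.
Context {R : realType}.

(** The analogue of [is_mean] for functions of an integer count, where no measurability condition
    arises; it serves both for averages over S(x) and for the Bernoulli law of [size D]. *)
Record is_count_mean (M : (nat -> R) -> R) : Prop := IsCountMean {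
  cmean1 : M (fun=> 1) = 1;
  cmeanD : forall g h, M (fun n => g n + h n) = M g + M h;
  cmeanZ : forall c g, M (fun n => c * g n) = c * M g;
  cmean_le : forall g h, (forall n, g n <= h n) -> M g <= M h }.

Lemma cmeanB M g h : is_count_mean M -> M (fun n => g n - h n) = M g - M h.
Proof.
move=> hM; have -> : (fun n => g n - h n) = (fun n => g n + (-1) * h n).
  by apply/funext => n; rewrite mulN1r.
by rewrite cmeanD// cmeanZ// mulN1r.
Qed.

Lemma cmean_norm_le M g h : is_count_mean M -> (forall n, `|g n| <= h n) -> `|M g| <= M h.
Proof.
move=> hM gh; rewrite ler_norml; apply/andP; split; last first.
  by apply: cmean_le => // n; exact: le_trans (ler_norm _) (gh n).
rewrite -mulN1r -cmeanZ//; apply: cmean_le => // n.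
by rewrite mulN1r; have := gh n; rewrite ler_norml => /andP[].
Qed.

Lemma bern_count_mean {P : eqType} (lam : P -> R) s : (forall l, 0 <= lam l <= 1) ->
  is_count_mean (fun g => bern lam s (fun D => g (size D))).
Proof.
move=> lam01; split=> [|g h|c g|g h gh]; first exact: bern_cst.
- exact: bernD.
- exact: bernZ.
- by apply: ler_bern => [l _|D]; [exact: lam01|exact: gh].
Qed.

Lemma expR_le_quad (h : R) : h <= 1 / 2 -> expR h - 1 <= h + 2 * h ^+ 2.
Proof.
move=> h2; have h1 : 0 < 1 - h by lra.
have e1 : (1 - h) * expR h <= 1.
  have := expR_ge1Dx (- h); rewrite expRN => e1.
  by rewrite -ler_pdivlMr ?expR_gt0// div1r.
have e0 := expR_gt0 h.
rewrite lerBlDr -(ler_pM2l h1) (le_trans e1)//.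
have -> : (1 - h) * (h + 2 * h ^+ 2 + 1) = 1 + h ^+ 2 * (1 - 2 * h) by ring.
by rewrite lerDl mulr_ge0 ?sqr_ge0// subr_ge0; lra.
Qed.

Lemma even_power_le_exp k (w : R) :
  w ^+ (k.+1 * 2) / ((k.+1 * 2)`!%:R) <= expR w + expR (- w).
Proof.
have -> : w ^+ (k.+1 * 2) = `|w| ^+ (k.+1 * 2).
  by rewrite mulnC !exprM real_normK ?num_real.
rewrite mulSn addSn.
have h : `|w| ^+ (1 + k * 2).+1 / (1 + k * 2).+1`!%:R <= expR `|w|.
  by have := expR_ge1Dxn (1 + k * 2) (normr_ge0 w); lra.
apply: (le_trans h); have := expR_ge0 w; have := expR_ge0 (- w).
by case: (ler0P w) => _; lra.
Qed.

End CountMean.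

(** * Transfer of moments and convergence of cosine means *)

Section MomentCLT.
Context {R : realType} {I : Type} {F : set_system I} {FF : Filter F} {P : eqType}.
Variables (lam : P -> R) (s : I -> seq P) (M : I -> (nat -> R) -> R) (L : I -> R).
Hypothesis lam01 : forall l, 0 <= lam l <= 1.
Hypothesis us : forall x, uniq (s x).
Hypothesis hM : \forall x \near F, is_count_mean (M x).
Hypothesis hL : L x @[x --> F] --> +oo.
Let Lam x := \sum_(l <- s x) lam l.
Let Lam2 x := \sum_(l <- s x) lam l ^+ 2.
Hypothesis hLam : (Lam x - L x) / Num.sqrt (L x) @[x --> F] --> 0.
Hypothesis hLam2 : Lam2 x / Num.sqrt (L x) @[x --> F] --> 0.
Hypothesis hmom : forall u K, L x ^+ K *
  (M x (fun n => (n ^_ u)%:R) - \sum_(t <- uniq_words u (s x)) \prod_(l <- t) lam l)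
  @[x --> F] --> 0.

Let B x (g : nat -> R) := bern lam (s x) (fun D => g (size D)).
Let delta x g := M x g - B x g.
Let hB x : is_count_mean (B x). Proof. exact: bern_count_mean. Qed.

Lemma bern_ffact x u : B x (fun n => (n ^_ u)%:R) =
  \sum_(t <- uniq_words u (s x)) \prod_(l <- t) lam l.
Proof.
have -> : B x (fun n => (n ^_ u)%:R) =
   bern lam (s x) (fun D => \sum_(t <- uniq_words u (s x)) (all (mem D) t)%:R).
  apply: eq_bern => D Ds; rewrite sum_uniq_words//; first exact: subseq_uniq Ds (us x).
  exact: mem_subseq.
rewrite bern_sum big_seq [RHS]big_seq; apply: eq_bigr => t.
by rewrite mem_uniq_words => /and3P[_ ut /allP ts]; rewrite bern_subset.
Qed.

(** Smaller than every power of 1/L. Stability under multiplication by L is what makes recentring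
    the moments at L free of charge. *)
Let small (g : I -> R) := forall K, L x ^+ K * g x @[x --> F] --> 0.

Let smallD g h : small g -> small h -> small (fun x => g x + h x).
Proof.
move=> sg sh K.
have : L x ^+ K * g x + L x ^+ K * h x @[x --> F] --> (0 + 0 : R) by exact: cvgD.
rewrite addr0; apply: cvg_trans; apply: near_eq_cvg; apply: nearW => x /=; ring.
Qed.

Let smallZ c g : small g -> small (fun x => c * g x).
Proof.
move=> sg K.
have : c * (L x ^+ K * g x) @[x --> F] --> (c * 0 : R) by apply: cvgM => //; exact: cvg_cst.
rewrite mulr0; apply: cvg_trans; apply: near_eq_cvg; apply: nearW => x /=; ring.
Qed.

Let smallL g : small g -> small (fun x => L x * g x).
Proof. by move=> sg K; under eq_fun do rewrite mulrA -exprSr; exact: sg. Qed.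

Let small_near g h : (\forall x \near F, g x = h x) -> small g -> small h.
Proof.
move=> gh sg K; apply: cvg_trans (sg K); apply: near_eq_cvg.
by apply: filterS gh => x ->.
Qed.

(** Expanding n times n^_u as n^_(u+1) + u n^_u absorbs one factor n - c. Iterated, it reduces the
    centred moments to factorial ones. *)
Lemma ffact_shift (n u : nat) (c : R) k :
  (n ^_ u)%:R * (n%:R - c) ^+ k.+1 =
  (n ^_ u.+1)%:R * (n%:R - c) ^+ k + (u%:R * ((n ^_ u)%:R * (n%:R - c) ^+ k)
   + (- c) * ((n ^_ u)%:R * (n%:R - c) ^+ k)).
Proof.
rewrite ffactnSr natrM exprS.
have [un|nu] := leqP u n; first by rewrite natrB//; ring.
(* For n < u the truncated difference n - u is harmless, the falling factorial being 0. *)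
by rewrite ffact_small//; ring.
Qed.

Lemma small_delta k u : small (fun x => delta x (fun n => (n ^_ u)%:R * (n%:R - L x) ^+ k)).
Proof.
elim: k u => [|k IH] u.
  apply: (small_near (nearW _ _)) (hmom u) => x /=.
  by rewrite /delta -bern_ffact; congr (M x _ - B x _); apply/funext => n; rewrite expr0 mulr1.
apply: (small_near _ (smallD (IH u.+1)
  (smallD (smallZ u%:R (IH u)) (smallZ (-1) (smallL (IH u)))))).
apply: filterS hM => x hx.
rewrite /delta; under [in RHS]eq_fun do rewrite ffact_shift.
rewrite !cmeanD// !cmeanZ//; ring.
Qed.

Let sq x := Num.sqrt (L x).
Let Z x (n : nat) := (n%:R - L x) / sq x.

Let nearL c : \forall x \near F, c <= L x.
Proof. by move/cvgryPge : hL; apply. Qed.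

Let sqE x : 1 <= L x -> L x = sq x ^+ 2.
Proof. by move=> L1; rewrite sqr_sqrtr// (le_trans ler01). Qed.

Let sq_ge1 x : 1 <= L x -> 1 <= sq x.
Proof. by move=> L1; rewrite -[1]sqrtr1 ler_sqrt// (le_trans ler01). Qed.

(** The case u = 0, K = 0 of [small_delta] suffices, since normalization divides by a power of
    sqrt(L) that is at least 1. *)
Lemma cvg_delta_pow k : delta x (fun n => Z x n ^+ k) @[x --> F] --> 0.
Proof.
have := @small_delta k 0 0; move/cvgr0Pnorm_le => h; apply/cvgr0Pnorm_le => e e0.
near=> x.
have hx : is_count_mean (M x) by near: x.
have L1 : 1 <= L x by near: x; exact: nearL.
have s1 := sq_ge1 L1.
have -> : delta x (fun n => Z x n ^+ k) =
   (sq x ^+ k)^-1 * delta x (fun n => (n ^_ 0)%:R * (n%:R - L x) ^+ k).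
  have -> : (fun n => Z x n ^+ k) = (fun n => (sq x ^+ k)^-1 * ((n ^_ 0)%:R * (n%:R - L x) ^+ k)).
    by apply/funext => n; rewrite /Z ffactn0 mul1r exprMn exprVn mulrC.
  by rewrite /delta !cmeanZ// mulrBr.
have : `|L x ^+ 0 * delta x (fun n => (n ^_ 0)%:R * (n%:R - L x) ^+ k)| <= e.
  by near: x; exact: h.
rewrite expr0 mul1r; apply: le_trans; rewrite normrM ler_piMl//.
have sk : 1 <= sq x ^+ k by rewrite exprn_ege1.
by rewrite ger0_norm ?invr_ge0 ?(le_trans ler01)// invf_le1 ?(lt_le_trans ltr01).
Unshelve. all: by end_near. Qed.

Lemma cvg_delta_taylor n t a : delta x (fun m => cos_taylor n a (t * Z x m)) @[x --> F] --> 0.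
Proof.
elim: n => [|n IH] /=.
  apply: cvg_near_cst; apply: filterS hM => x hx.
  have -> : (fun=> 0 : R) = (fun m : nat => 0 * 0 : R) by apply/funext => ?; rewrite mul0r.
  by rewrite /delta !cmeanZ// !mul0r subrr.
have h : delta x (fun m => cos_taylor n a (t * Z x m)) +
   (cos (a + n%:R * (pi / 2)) * t ^+ n / n`!%:R) * delta x (fun m => Z x m ^+ n) @[x --> F] --> 0.
  rewrite -[X in _ --> X](addr0 (0 : R)); apply: cvgD => //.
  rewrite -[X in _ --> X](mulr0 (cos (a + n%:R * (pi / 2)) * t ^+ n / n`!%:R)).
  by apply: cvgM; [exact: cvg_cst|exact: cvg_delta_pow].
apply: cvg_trans h; apply: near_eq_cvg; apply: filterS hM => x hx.
rewrite {3}/delta !cmeanD//.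
have -> : (fun m => cos (a + n%:R * (pi / 2)) * ((t * Z x m) ^+ n / n`!%:R)) =
    (fun m => (cos (a + n%:R * (pi / 2)) * t ^+ n / n`!%:R) * Z x m ^+ n).
  by apply/funext => m; rewrite exprMn; ring.
by rewrite !cmeanZ// /delta; ring.
Qed.

Let Lam_ge0 x : 0 <= Lam x.
Proof. by rewrite sumr_ge0// => l _; case/andP: (lam01 l). Qed.

(** With Lam = L + r sqrt(L) and |r| <= 1, the term c sqrt(L) from the centring cancels the main
    linear term of Lam (e^{c/sqrt(L)} - 1). At most r c + 2 c^2 (1 + r/sqrt(L)) remains, a bound
    uniform in x. *)
Lemma bern_exp_bound c : \forall x \near F,
  B x (fun n => expR (c * Z x n)) <= expR (`|c| + 4 * c ^+ 2).
Proof.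
near=> x.
have L1 : 1 <= L x by near: x; exact: nearL.
have s1 := sq_ge1 L1; have s0 : 0 < sq x by apply: lt_le_trans s1.
have LE := sqE L1.
have cs : c / sq x <= 1 / 2.
  rewrite ler_pdivrMr// (le_trans (ler_norm _))//.
  have : (2 * `|c|) ^+ 2 <= L x by near: x; exact: nearL.
  rewrite LE => h; suff : 2 * `|c| <= sq x by lra.
  by rewrite -(ler_pXn2r (n := 2)) ?nnegrE ?mulr_ge0// ltW.
have r1 : `|(Lam x - L x) / sq x| <= 1.
  by near: x; move/cvgr0Pnorm_le : hLam; apply.
have -> : B x (fun n => expR (c * Z x n)) =
    expR (- (c * sq x)) * B x (fun n => expR (c / sq x * n%:R)).
  rewrite -cmeanZ//; congr (B x _); apply/funext => n; rewrite -expRD; congr expR.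
  by rewrite /Z {1}LE; field; rewrite gt_eqF.
have hb : B x (fun n => expR (c / sq x * n%:R)) <= expR (Lam x * (expR (c / sq x) - 1)).
  by apply: bern_exp => l _.
apply: (@le_trans _ _ (expR (- (c * sq x)) * expR (Lam x * (expR (c / sq x) - 1)))).
  by rewrite ler_wpM2l ?expR_ge0.
rewrite -expRD ler_expR.
have := ler_wpM2l (Lam_ge0 x) (expR_le_quad cs).
move: r1; set r := (_ / sq x) => r1.
have LamE : Lam x = L x + r * sq x by rewrite /r mulfVK ?gt_eqF// addrC subrK.
have -> : Lam x * (c / sq x + 2 * (c / sq x) ^+ 2) = c * sq x + r * c + 2 * c ^+ 2 * (1 + r / sq x).
  by rewrite LamE LE; field; rewrite gt_eqF.
have rc : r * c <= `|c|.
  by rewrite (le_trans (ler_norm _))// normrM ler_piMl.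
have rs : r / sq x <= 1.
  by rewrite (le_trans (ler_norm _))// normrM mulr_ile1// normfV invf_le1 ger0_norm// ltW.
have : 2 * c ^+ 2 * (1 + r / sq x) <= 2 * c ^+ 2 * 2.
  by apply: ler_wpM2l; [rewrite mulr_ge0 ?sqr_ge0|lra].
lra.
Unshelve. all: by end_near. Qed.

(** The geometric factor comes from using the exponential moment at 2t instead of t: the even power
    then gains 4^-(k+1), which lets the Taylor order be fixed before x. *)
Lemma bern_tail k t : \forall x \near F,
  B x (fun n => (t * Z x n) ^+ (k.+1 * 2) / (k.+1 * 2)`!%:R) <=
  (4 ^- k.+1) * (2 * expR (`|2 * t| + 4 * (2 * t) ^+ 2)).
Proof.
near=> x.
have h1 : B x (fun n => expR ((2 * t) * Z x n)) <= expR (`|2 * t| + 4 * (2 * t) ^+ 2).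
  by near: x; exact: bern_exp_bound.
have h2 : B x (fun n => expR (- (2 * t) * Z x n)) <= expR (`|2 * t| + 4 * (2 * t) ^+ 2).
  by near: x; have := bern_exp_bound (- (2 * t)); rewrite normrN sqrrN.
have -> : (fun n => (t * Z x n) ^+ (k.+1 * 2) / (k.+1 * 2)`!%:R) =
    (fun n => 4 ^- k.+1 * ((2 * t * Z x n) ^+ (k.+1 * 2) / (k.+1 * 2)`!%:R)).
  apply/funext => n; rewrite -(mulrA 2) (exprMn _ 2) [in RHS]mulnC [in 2 ^+ _]exprM.
  have -> : 2 ^+ 2 = 4 :> R by ring.
  by rewrite mulnC; field; rewrite expf_neq0//= pnatr_eq0 -lt0n fact_gt0.
rewrite cmeanZ// ler_wpM2l ?invr_ge0 ?exprn_ge0//.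
rewrite [leRHS]mulr_natl mulr2n (le_trans _ (lerD h1 h2))// -cmeanD//.
by apply: cmean_le => // n; rewrite mulNr even_power_le_exp.
Unshelve. all: by end_near. Qed.

(** Input for Chebyshev's inequality in the proof of tightness; the Bernoulli part is [bern_tail]
    with k = 0 and t = 1. *)
Lemma second_moment_bound : exists C, \forall x \near F, M x (fun n => Z x n ^+ 2) <= C.
Proof.
pose C := 2 * (4 ^- 1 * (2 * expR (`|2 * 1| + 4 * (2 * 1) ^+ 2))) : R.
exists (1 + C); near=> x.
have h1 : `|delta x (fun n => Z x n ^+ 2)| <= 1.
  by near: x; move/cvgr0Pnorm_le : (@cvg_delta_pow 2); apply.
have : B x (fun n => (1 * Z x n) ^+ (1 * 2) / (1 * 2)`!%:R) <=
  4 ^- 1 * (2 * expR (`|2 * 1| + 4 * (2 * 1) ^+ 2)).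
  by near: x; exact: (bern_tail 0 1).
have -> : (fun n => (1 * Z x n) ^+ (1 * 2) / (1 * 2)`!%:R) = (fun n => 2^-1 * Z x n ^+ 2).
  by apply/funext => n; rewrite mul1r mul1n mulrC.
rewrite cmeanZ//.
move: (ler_norm (delta x (fun n => Z x n ^+ 2))); rewrite {1}/delta /C; lra.
Unshelve. all: by end_near. Qed.

(** The order N = 2(k+1) is even, so the remainder bound [w] is a monomial in Z without absolute
    value. Its mean under M is its Bernoulli mean plus a vanishing difference, and the Taylor
    polynomial is handled by [cvg_delta_taylor]. *)
Lemma cvg_delta_cos t a : delta x (fun n => cos (t * Z x n + a)) @[x --> F] --> 0.
Proof.
apply/cvgr0Pnorm_le => e e0.
pose C := 2 * expR (`|2 * t| + 4 * (2 * t) ^+ 2).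
have [k hk] : exists k, 4 ^- k.+1 * C <= e / 4.
  have : C * 4^-1 ^+ k @[k --> \oo] --> 0.
    rewrite -[X in _ --> X](mulr0 C); apply: cvgM; first exact: cvg_cst.
    by apply: cvg_expr; rewrite ger0_norm//; lra.
  have e4 : 0 < e / 4 by rewrite divr_gt0.
  move/cvgr0Pnorm_le => /(_ _ e4) [k _ /(_ k.+1 (leqnSn k))] /= h.
  by exists k; rewrite mulrC -exprVn (le_trans (ler_norm _)).
pose N := (k.+1 * 2)%N; pose w x n := (t * Z x n) ^+ N / N`!%:R.
pose d x n := cos (t * Z x n + a) - cos_taylor N a (t * Z x n).
have dw x n : `|d x n| <= w x n.
  apply: le_trans (cos_taylor_bound _ _ _) _.
  by rewrite /w /N mulnC !exprM real_normK ?num_real.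
have h : delta x (w x) @[x --> F] --> 0.
  have h : (t ^+ N / N`!%:R) * delta x (fun n => Z x n ^+ N) @[x --> F] --> 0.
    rewrite -[X in _ --> X](mulr0 (t ^+ N / N`!%:R)).
    by apply: cvgM; [exact: cvg_cst|exact: cvg_delta_pow].
  apply: cvg_trans h; apply: near_eq_cvg; apply: filterS hM => z hz.
  have -> : w z = (fun n => t ^+ N / N`!%:R * Z z n ^+ N).
    by apply/funext => m; rewrite /w exprMn mulrAC.
  by rewrite /delta !cmeanZ// mulrBr.
have hw : \forall x \near F, `|delta x (w x)| <= e / 4.
  by move/cvgr0Pnorm_le : h; apply; rewrite divr_gt0.
near=> x.
have hx : is_count_mean (M x) by near: x.
have b1 : B x (w x) <= e / 4.
  by apply: le_trans hk; near: x; exact: bern_tail.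
have b2 : `|delta x (w x)| <= e / 4.
  by near: x; exact: hw.
have b3 : `|delta x (fun m => cos_taylor N a (t * Z x m))| <= e / 4.
  by near: x; move/cvgr0Pnorm_le : (@cvg_delta_taylor N t a); apply; rewrite divr_gt0.
have -> : delta x (fun n => cos (t * Z x n + a)) =
    (M x (d x) - B x (d x)) + delta x (fun m => cos_taylor N a (t * Z x m)).
  by rewrite /d !cmeanB// /delta; ring.
have m1 := cmean_norm_le hx (dw x).
have m2 := cmean_norm_le (hB x) (dw x).
have b4 : M x (w x) <= e / 2.
  by move: (le_trans (ler_norm _) b2); rewrite /delta; lra.
apply: le_trans (ler_normD _ _) _.
have := ler_normB (M x (d x)) (B x (d x)); lra.
Unshelve. all: by end_near. Qed.

Lemma cvg_dist_le (f g : I -> R) (l : R) :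
  (\forall x \near F, `|f x - l| <= g x) -> g x @[x --> F] --> 0 -> f x @[x --> F] --> l.
Proof.
move=> fg g0; apply: (@squeeze_cvgr _ _ _ _ (fun x => l - g x) (fun x => l + g x)).
- by apply: filterS fg => x; rewrite ler_norml => /andP[h1 h2]; apply/andP; split; lra.
- by rewrite -[X in _ --> X]subr0; apply: cvgB => //; exact: cvg_cst.
- by rewrite -[X in _ --> X]addr0; apply: cvgD => //; exact: cvg_cst.
Qed.

Let cvg_sqV : (sq x)^-1 @[x --> F] --> 0.
Proof.
apply/cvgr0Pnorm_le => e e0.
have hx : \forall x \near F, e ^- 2 <= L x by exact: nearL.
have hx1 : \forall x \near F, 1 <= L x by exact: nearL.
near=> x.
have L1 : 1 <= L x by near: x.
have s0 : 0 < sq x by exact: lt_le_trans (sq_ge1 L1).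
rewrite ger0_norm ?invr_ge0 ?(ltW s0)// -[leRHS]invrK lef_pV2 ?posrE ?invr_gt0//.
rewrite -(ler_pXn2r (n := 2)) ?nnegrE ?invr_ge0 ?(ltW s0) ?(ltW e0)//.
by rewrite -sqE// exprVn; near: x.
Unshelve. all: by end_near. Qed.

Lemma bern_cos_cvg t a :
  B x (fun n => cos (t * Z x n + a)) @[x --> F] --> expR (- (t ^+ 2 / 2)) * cos a.
Proof.
pose q x := (sq x)^-1; pose r x := (Lam x - L x) / sq x.
(* Modulus and phase of the Poisson comparison: [A] tends to t^2/2, while in [D] the centring t
   sqrt(L) cancels the first-order part of Lam sin(t/sqrt(L)). *)
pose A x := Lam x * (1 - cos (t * q x)).
pose D x := Lam x * sin (t * q x) - t * sq x.
pose eps x := B x (fun n => cos (t * Z x n + a)) - expR (- A x) * cos (a + D x).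
have q0 : q x @[x --> F] --> 0 by exact: cvg_sqV.
have r0 : r x @[x --> F] --> 0 by exact: hLam.
have nr0 : `|r x| @[x --> F] --> 0 by rewrite -[X in _ --> X](@normr0 _ R); exact: cvg_norm.
have u0 : `|t| ^+ 3 * (q x * (1 + `|r x| * q x)) @[x --> F] --> 0.
  rewrite -[X in _ --> X](mulr0 (`|t| ^+ 3)); apply: cvgM; first exact: cvg_cst.
  rewrite -[X in _ --> X](mul0r (1 + 0 * 0)); apply: cvgM => //.
  by apply: cvgD; [exact: cvg_cst|exact: cvgM].
have facts : \forall x \near F, [/\ 0 < sq x, L x = sq x ^+ 2 & Lam x = sq x ^+ 2 + r x * sq x].
  have hx1 := nearL 1.
  apply: filterS hx1 => x L1.
  have s0 : 0 < sq x by exact: lt_le_trans (sq_ge1 L1).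
  by split => //; [exact: sqE|rewrite /r mulfVK ?gt_eqF// -sqE// addrC subrK].
(* Third-order Taylor remainders are multiplied by Lam, of size L, and hence are O(L^(-1/2)). *)
have third x : 0 < sq x -> Lam x = sq x ^+ 2 + r x * sq x ->
    Lam x * (`|t * q x| ^+ 3 / 6) <= `|t| ^+ 3 * (q x * (1 + `|r x| * q x)).
  move=> s0 LE.
  have qp : 0 <= q x by rewrite invr_ge0 ltW.
  have -> : Lam x * (`|t * q x| ^+ 3 / 6) = `|t| ^+ 3 * (q x * (1 + r x * q x)) / 6.
    by rewrite normrM (ger0_norm qp) LE /q; field; rewrite gt_eqF.
  have rn : r x * q x <= `|r x| * q x by rewrite ler_wpM2r// ler_norm.
  have t3 : 0 <= `|t| ^+ 3 by rewrite exprn_ge0.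
  have : `|t| ^+ 3 * (q x * (1 + r x * q x)) <= `|t| ^+ 3 * (q x * (1 + `|r x| * q x)).
    by rewrite ler_wpM2l// ler_wpM2l// lerD2l.
  have : 0 <= `|t| ^+ 3 * (q x * (1 + `|r x| * q x)).
    by rewrite mulr_ge0// mulr_ge0// addr_ge0// mulr_ge0.
  lra.
have cvgA : A x @[x --> F] --> t ^+ 2 / 2.
  apply: (@cvg_dist_le _ (fun x =>
    `|t| ^+ 3 * (q x * (1 + `|r x| * q x)) + t ^+ 2 / 2 * (`|r x| * q x))).
    apply: filterS facts => x [s0 _ LE].
    have qp : 0 <= q x by rewrite invr_ge0 ltW.
    have := cos_taylor_bound 3 0 (t * q x).
    have -> : cos_taylor 3 0 (t * q x) = 1 - (t * q x) ^+ 2 / 2.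
      have -> /= : cos_taylor 3 0 (t * q x) =
          0 + cos (0 + 0 * (pi / 2)) * ((t * q x) ^+ 0 / 1) +
          cos (0 + 1 * (pi / 2)) * ((t * q x) ^+ 1 / 1) +
          cos (0 + 2 * (pi / 2)) * ((t * q x) ^+ 2 / 2) by [].
      have -> : 0 + 0 * (pi / 2) = 0 :> R by ring.
      have -> : 0 + 1 * (pi / 2) = pi / 2 :> R by ring.
      have -> : 0 + 2 * (pi / 2) = pi :> R by field.
      by rewrite cos0 cos_pihalf cospi expr0; field.
    rewrite addr0 => h.
    have -> : A x - t ^+ 2 / 2 =
        - (Lam x * (cos (t * q x) - (1 - (t * q x) ^+ 2 / 2))) + t ^+ 2 / 2 * (r x * q x).
      by rewrite /A [in X in _ = - (X * _) + _]LE LE /q; field; rewrite gt_eqF.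
    apply: le_trans (ler_normD _ _) _; apply: lerD.
      rewrite normrN normrM ger0_norm//; apply: le_trans (third _ s0 LE).
      exact: ler_wpM2l.
    rewrite normrM ger0_norm ?divr_ge0 ?sqr_ge0// ler_wpM2l ?divr_ge0 ?sqr_ge0//.
    by rewrite normrM (ger0_norm qp).
  rewrite -[X in _ --> X](addr0 (0 : R)); apply: cvgD => //.
  rewrite -[X in _ --> X](mulr0 (t ^+ 2 / 2)); apply: cvgM; first exact: cvg_cst.
  by rewrite -[X in _ --> X](mulr0 (0 : R)); exact: cvgM.
have cvgD0 : D x @[x --> F] --> 0.
  apply: (@cvg_dist_le _ (fun x => `|t| ^+ 3 * (q x * (1 + `|r x| * q x)) + `|t| * `|r x|)).
    apply: filterS facts => x [s0 _ LE].
    have qp : 0 <= q x by rewrite invr_ge0 ltW.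
    (* The sine is treated as a cosine of phase -pi/2. *)
    have := cos_taylor_bound 3 (- (pi / 2)) (t * q x).
    have -> : cos_taylor 3 (- (pi / 2)) (t * q x) = t * q x.
      have -> /= : cos_taylor 3 (- (pi / 2)) (t * q x) =
          0 + cos (- (pi / 2) + 0 * (pi / 2)) * ((t * q x) ^+ 0 / 1) +
          cos (- (pi / 2) + 1 * (pi / 2)) * ((t * q x) ^+ 1 / 1) +
          cos (- (pi / 2) + 2 * (pi / 2)) * ((t * q x) ^+ 2 / 2) by [].
      have -> : - (pi / 2) + 0 * (pi / 2) = - (pi / 2) :> R by ring.
      have -> : - (pi / 2) + 1 * (pi / 2) = 0 :> R by ring.
      have -> : - (pi / 2) + 2 * (pi / 2) = pi / 2 :> R by field.
      by rewrite cosN cos_pihalf cos0 expr1; field.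
    rewrite cosBpihalf => h.
    have -> : D x - 0 = Lam x * (sin (t * q x) - t * q x) + t * r x.
      by rewrite /D [in X in _ = X * _ + _]LE LE /q; field; rewrite gt_eqF.
    apply: le_trans (ler_normD _ _) _; rewrite normrM (normrM t); apply: lerD => //.
    by rewrite ger0_norm//; apply: le_trans (third _ s0 LE); exact: ler_wpM2l.
  rewrite -[X in _ --> X](addr0 (0 : R)); apply: cvgD => //.
  by rewrite -[X in _ --> X](mulr0 `|t|); apply: cvgM => //; exact: cvg_cst.
have cvgeps : eps x @[x --> F] --> 0.
  apply: (@cvg_dist_le _ (fun x => 4 * t ^+ 2 * (q x * (Lam2 x / sq x)))).
    apply: filterS facts => x [s0 LE _].
    rewrite subr0.
    have := bern_cos (t * q x) (a - t * sq x) (fun l (_ : l \in s x) => lam01 l).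
    rewrite -/(Lam x) -/(Lam2 x) -/(A x).
    have -> : a - t * sq x + Lam x * sin (t * q x) = a + D x by rewrite /D; ring.
    have -> : bern lam (s x) (fun D => cos (a - t * sq x + t * q x * (size D)%:R)) =
              B x (fun n => cos (t * Z x n + a)).
      apply: eq_bern => D' _; congr cos.
      by rewrite /Z LE /q; field; rewrite gt_eqF.
    rewrite -/(eps x) => h; apply: (le_trans h).
    by rewrite le_eqVlt; apply/orP; left; apply/eqP; rewrite /q; field; rewrite gt_eqF.
  rewrite -[X in _ --> X](mulr0 (4 * t ^+ 2)); apply: cvgM; first exact: cvg_cst.
  by rewrite -[X in _ --> X](mulr0 (0 : R)); exact: cvgM.
have main : eps x + expR (- A x) * cos (a + D x) @[x --> F] --> 0 + expR (- (t ^+ 2 / 2)) * cos (a + 0).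
  apply: cvgD => //; apply: cvgM.
    by apply: continuous_cvg; [exact: continuous_expR|exact: cvgN].
  by apply: continuous_cvg; [exact: continuous_cos|apply: cvgD => //; exact: cvg_cst].
rewrite add0r addr0 in main.
by apply: cvg_trans main; apply: near_eq_cvg; apply: nearW => x; rewrite /eps subrK.
Qed.

Lemma moment_cos_cvg t a :
  M x (fun n => cos (t * Z x n + a)) @[x --> F] --> expR (- (t ^+ 2 / 2)) * cos a.
Proof.
have h : delta x (fun n => cos (t * Z x n + a)) + B x (fun n => cos (t * Z x n + a))
    @[x --> F] --> 0 + expR (- (t ^+ 2 / 2)) * cos a.
  by apply: cvgD; [exact: cvg_delta_cos|exact: bern_cos_cvg].
rewrite add0r in h; apply: cvg_trans h; apply: near_eq_cvg; apply: nearW => x.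
by rewrite /delta subrK.
Qed.

End MomentCLT.

(** * Tails and continuity of the Gaussian distribution function *)

Section GaussTail.
Context {R : realType}.
Local Notation mu := (@lebesgue_measure R).
Local Notation phi := (normal_pdf (0 : R) 1).

Lemma phi_le1 (u : R) : phi u <= 1.
Proof.
apply: le_trans (normal_pdf_ub _ _ (oner_neq0 _)) _.
rewrite /normal_peak expr1n mul1r invf_le1; last by rewrite sqrtr_gt0 mulrn_wgt0// pi_gt0.
have pi2 := @pi_ge2 R.
by rewrite -[leLHS]sqrtr1 ler_sqrt mulr2n; lra.
Qed.

Lemma integrable_norm_phi : mu.-integrable setT (EFin \o (fun u => `|u| * phi u)).
Proof.
apply: (@integrable_linear_bell _ _ (Num.sqrt (2 * pi))^-1).
  by apply: measurable_funM; [exact: normr_measurable|exact: measurable_normal_pdf].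
by move=> u; rewrite normrM normr_id ger0_norm ?normal_pdf_ge0// phiE mulrCA mulrA.
Qed.

(** Markov's inequality with |u - c| <= |u| + |c|, whose Gaussian mean is the constant [K]. *)
Lemma gauss_mean_far (c e : R) : 0 < e ->
  exists B0, forall B, B0 <= B -> gauss_mean \1_(far c B) <= e.
Proof.
move=> e0.
pose K := (\int[mu]_u (`|u| * phi u + `|c| * phi u))%R.
exists (Num.max 1 (K / e)) => B; rewrite ge_max => /andP[B1 BK].
have B0 : 0 < B by apply: lt_le_trans B1.
have i1 : mu.-integrable setT (EFin \o (fun u => `|c| * phi u)).
  exact: integrableZl (integrable_normal_pdf 0 1).
have i2 : mu.-integrable setT (EFin \o (fun u => `|u| * phi u + `|c| * phi u)).
  exact: (integrableD measurableT integrable_norm_phi i1).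
apply: (@le_trans _ _ (B^-1 * K)); last by rewrite mulrC ler_pdivrMr// mulrC -ler_pdivrMr.
rewrite /K -RintegralZl//; apply: le_Rintegral => //.
- exact: integrable_gauss (bounded_measurable_indic (measurable_far c B)).
- exact: (integrableZl measurableT B^-1 i2).
- move=> u _; rewrite -mulrDl mulrA ler_wpM2r ?normal_pdf_ge0//.
  rewrite indicE; have [|_] := boolP (u \in far c B).
    rewrite inE /far /= => h; rewrite mulrC ler_pdivlMr// mul1r ltW// (lt_le_trans h)//.
    exact: ler_normB.
  by rewrite mulr_ge0 ?invr_ge0 ?(ltW B0)// addr_ge0.
Qed.

(** The density is at most 1, so an interval of length d has Gaussian mass at most d. *)
Lemma Phi_lipschitz (c d : R) : 0 <= d -> Phi c <= Phi (c + d) <= Phi c + d.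
Proof.
move=> d0; rewrite -!gauss_mean_below.
have hG := @gauss_mean_is_mean R.
have b1 := bounded_measurable_indic (measurable_below c).
have b2 := bounded_measurable_indic (measurable_below (c + d)).
pose J : set R := [set` `]c, (c + d)%R] ].
have mJ : measurable J by exact: measurable_itv.
have b3 := bounded_measurable_indic mJ.
have muJ : mu J = d%:E.
  rewrite /J lebesgue_measure_itv/= lte_fin ltrDl.
  have [d1|d1] := ltP 0 d; first by rewrite -EFinB addrAC subrr add0r.
  by congr (_%:E); apply/eqP; rewrite eq_le d0 d1.
have GJ : gauss_mean \1_J <= d.
  have -> : d = (\int[mu]_u (\1_J u : R))%R.
    by rewrite /Rintegral integral_indic// setIT; exact: (esym (congr1 fine muJ)).
  apply: le_Rintegral => //.
  - exact: integrable_gauss.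
  - exact: integrable_indic_itv.
  - by move=> u _; rewrite ler_piMr ?phi_le1// indicE.
apply/andP; split.
  apply: mean_le => // z; rewrite !indicE.
  have [|_] := boolP (z \in below c); last by [].
  by rewrite inE /below /= => zc; rewrite mem_set//=; lra.
apply: (@le_trans _ _ (gauss_mean \1_(below c) + gauss_mean \1_J)); last by rewrite lerD2l.
rewrite -meanD//; apply: mean_le => //; first exact: bounded_measurableD.
move=> z; rewrite !indicE.
have [|_] := boolP (z \in below (c + d)); last by rewrite addr_ge0.
rewrite inE /below /= => zc.
have [zc'|zc'] := leP z c; first by rewrite (mem_set (A := below c))// lerDl.
by rewrite (mem_set (A := J)) ?lerDr// /J /= in_itv/= zc' zc.
Qed.
End GaussTail.

Section MomentCLTcdf.
Context {R : realType} {I : Type} {F : set_system I} {FF : Filter F} {P : eqType}.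
Variables (lam : P -> R) (s : I -> seq P) (M : I -> (nat -> R) -> R) (L : I -> R).
Hypothesis lam01 : forall l, 0 <= lam l <= 1.
Hypothesis us : forall x, uniq (s x).
Hypothesis hM : \forall x \near F, is_count_mean (M x).
Hypothesis hL : L x @[x --> F] --> +oo.
Hypothesis hLam : (\sum_(l <- s x) lam l - L x) / Num.sqrt (L x) @[x --> F] --> 0.
Hypothesis hLam2 : (\sum_(l <- s x) lam l ^+ 2) / Num.sqrt (L x) @[x --> F] --> 0.
Hypothesis hmom : forall u K, L x ^+ K *
  (M x (fun n => (n ^_ u)%:R) - \sum_(t <- uniq_words u (s x)) \prod_(l <- t) lam l)
  @[x --> F] --> 0.

Lemma moment_clt (c : R) :
  M x (fun n => \1_(below c) ((n%:R - L x) / Num.sqrt (L x))) @[x --> F] --> Phi c.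
Proof.
pose Z x (n : nat) : R := (n%:R - L x) / Num.sqrt (L x).
pose E x (g : R -> R) := M x (fun n => g (Z x n)).
have hE : \forall x \near F, is_mean (E x).
  apply: filterS hM => x hx; split => [|g h _ _|k g _|g h _ _ gh].
  - exact: cmean1.
  - exact: cmeanD.
  - exact: cmeanZ.
  - by apply: cmean_le => // n; exact: gh.
have hcos t a : E x (fun z => cos (t * z + a)) @[x --> F] --> gauss_mean (fun z => cos (t * z + a)).
  by rewrite gauss_mean_cos; exact: (moment_cos_cvg lam01 us hM hL hLam hLam2 hmom).
have [C hC] := second_moment_bound lam01 us hM hL hLam hmom.
have tight (k e : R) : 0 < e -> exists B0 : R, forall B, B0 <= B ->
    (\forall x \near F, E x \1_(far k B) <= e) /\ gauss_mean \1_(far k B) <= e.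
  move=> e0; have [B1 hB1] := gauss_mean_far k e0.
  (* Chebyshev: (Z - k)^2 <= 2 Z^2 + 2 k^2, so K/B^2 bounds the tail. The condition B >= 1 allows
     K/e <= B to suffice. *)
  pose K := 2 * `|C| + 2 * k ^+ 2.
  exists (Num.max B1 (Num.max 1 (K / e))) => B; rewrite !ge_max => /and3P[BB1 B1' BK].
  split; last exact: hB1.
  near=> x.
  have hx : is_count_mean (M x) by near: x.
  have hCx : M x (fun n => Z x n ^+ 2) <= C by near: x.
  have B0 : 0 < B by apply: lt_le_trans B1'.
  apply: (@le_trans _ _ (M x (fun n => (2 / B ^+ 2) * Z x n ^+ 2 + (2 * k ^+ 2 / B ^+ 2) * 1))).
    apply: cmean_le => // n; rewrite indicE; have [|_] := boolP (_ \in _).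
      rewrite inE /far /= => h.
      have h2 : B ^+ 2 <= (Z x n - k) ^+ 2.
        rewrite -(real_normK (num_real (Z x n - k))) ler_pXn2r ?nnegrE ?(ltW h)//.
        exact: ltW.
      have -> : 2 / B ^+ 2 * Z x n ^+ 2 + 2 * k ^+ 2 / B ^+ 2 * 1 =
          (2 * Z x n ^+ 2 + 2 * k ^+ 2) / B ^+ 2 by ring.
      rewrite ler_pdivlMr ?exprn_gt0// mul1r (le_trans h2)//.
      have := sqr_ge0 (Z x n + k).
      have -> : (Z x n + k) ^+ 2 = Z x n ^+ 2 + 2 * Z x n * k + k ^+ 2 by ring.
      have -> : (Z x n - k) ^+ 2 = Z x n ^+ 2 - 2 * Z x n * k + k ^+ 2 by ring.
      lra.
    rewrite mulr1; apply: addr_ge0;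
      [apply: mulr_ge0; [apply: divr_ge0|]|apply: divr_ge0; [apply: mulr_ge0|]] => //;
    exact: sqr_ge0.
  rewrite cmeanD// !cmeanZ// cmean1// mulr1.
  have h3 : M x (fun n => Z x n ^+ 2) <= `|C| := le_trans hCx (ler_norm C).
  apply: (@le_trans _ _ (K / B ^+ 2)).
    rewrite /K [leRHS]mulrDl; apply: lerD => //.
    by rewrite mulrAC ler_pM2r ?invr_gt0 ?exprn_gt0// ler_pM2l.
  rewrite ler_pdivrMr ?exprn_gt0//.
  have : K <= e * B by rewrite mulrC -ler_pdivrMr.
  by move=> /le_trans; apply; rewrite ler_pM2l// expr2 ler_peMl// ltW.
have hG := @gauss_mean_is_mean R.
apply/cvgrPdist_le => e e0.
have e2 : 0 < e / 2 by rewrite divr_gt0.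
(* Half of e is spent on the error and half on the shift, which changes Phi by at most e/2. *)
have := @cvg_below_sandwich R I F FF E gauss_mean hE hG hcos tight c _ _ e2 e2.
apply: filterS => x; rewrite !gauss_mean_below -/(E x \1_(below c)) => /andP[h1 h2].
have e20 := ltW e2.
have /andP[h3 h4] := Phi_lipschitz c e20.
have /andP[h5 h6] := Phi_lipschitz (c - e / 2) e20.
rewrite subrK in h5 h6.
by rewrite ler_norml; apply/andP; split; lra.
Unshelve. all: by end_near. Qed.
End MomentCLTcdf.

Lemma ln_le_sub (R : realType) (x : R) : 0 < x -> ln x <= x - 1.
Proof. by move=> x0; have := expR_ge1Dx (ln x); rewrite lnK ?posrE//; lra. Qed.

(** * The generalized Erdos-Kac theorem *)

Section InftyFilter.
Context {R : realType} (X : set R).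

Lemma near_infty_ge (c : R) : \forall x \near infty X, c <= x.
Proof.
rewrite /infty near_withinE.
by apply: filterS (nbhs_pinfty_ge (num_real c)) => x.
Qed.

Lemma near_infty_in : \forall x \near infty X, X x.
Proof. by rewrite /infty near_withinE; apply: nearW => x. Qed.

Lemma near_infty_loglog (c : R) : \forall x \near infty X, c <= ln (ln x).
Proof.
apply: filterS (near_infty_ge (expR (expR c))) => x h.
have e0 := expR_gt0 (expR c).
have x0 : 0 < x by exact: lt_le_trans h.
have h1 : expR c <= ln x by rewrite -ler_expR lnK.
have l0 : 0 < ln x by exact: lt_le_trans (expR_gt0 c) h1.
by rewrite -ler_expR lnK.
Qed.

Lemma cvg_loglog : ln (ln x) @[x --> infty X] --> +oo.
Proof. by apply/cvgryPge => c; exact: near_infty_loglog. Qed.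

End InftyFilter.

Section Card.
Context {R : realType}.

Lemma infinite_fset_set {T : choiceType} (A : set T) : infinite_set A -> fset_set A = fset0.
Proof. by move=> iA; rewrite /fset_set; case: pselect => // fA; case: iA. Qed.

Lemma ncard_sep {T : choiceType} (A : set T) (Q : T -> Prop) : finite_set A ->
  (ncard [set m | A m /\ Q m])%:R = \sum_(m <- fset_set A) (`[< Q m >])%:R :> R.
Proof.
move=> fA.
have fAQ : finite_set [set m | A m /\ Q m] by apply: sub_finite_set fA => m [].
rewrite /ncard -natr_sum; congr (_%:R).
rewrite -big_mkcond /= -[RHS]big_filter sum1_size.
apply: perm_size; apply: uniq_perm; rewrite ?filter_uniq ?fset_uniq// => m.
rewrite mem_filter /= in_fset_set// in_fset_set//.
apply/idP/andP => [|[/asboolP Qm]]; rewrite !inE => //=.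
by case.
Qed.

Lemma ncard_le {T : choiceType} (A B : set T) : finite_set B -> A `<=` B -> (ncard A <= ncard B)%N.
Proof.
move=> fB AB; apply: fsubset_leq_card; apply/fsubsetP => m.
by rewrite !in_fset_set//; [rewrite !inE => /AB|exact: sub_finite_set fB].
Qed.

Lemma sum_tuples_words {P : choiceType} (u : nat) (s : seq P) (Q : P -> Prop) (G : seq P -> R) :
  uniq s -> (forall l, l \in s <-> Q l) ->
  \sum_(t \in [set t : u.-tuple P | uniq t /\ forall i : 'I_u, Q (tnth t i)]) G t =
  \sum_(t <- uniq_words u s) G t.
Proof.
move=> us sQ; rewrite (fsbig_seq _ _ (uniq_uniq_words u us)).
rewrite (reindex_fsbig (fun t : u.-tuple P => tval t)
  [set t : u.-tuple P | uniq t /\ forall i : 'I_u, Q (tnth t i)])//.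
split.
- move=> t [ut tQ] /=; rewrite mem_uniq_words size_tuple eqxx ut /=.
  by apply/allP => l /tnthP[i ->]; apply/sQ.
- by move=> t t' _ _ /val_inj.
- move=> t /=; rewrite mem_uniq_words => /and3P[st ut /allP ts].
  exists (Tuple st) => //=; split => // i.
  by apply/sQ/ts; exact: mem_tnth.
Qed.

End Card.

Section FreeMonoid.
Context {R : realType} {P : choiceType}.
Variable N : P -> nat.

Definition basis (p : P) : freeM P := [fsfun q in [fset p]%fset => 1%N].

Lemma normM_basis p : normM N (basis p) = N p.
Proof.
have fs : finsupp (basis p) = [fset p]%fset.
  apply/fsetP => q; rewrite mem_finsupp inE /basis fsfunE inE.
  by case: ifP.
by rewrite /normM fs big_seq_fset1 /basis fsfunE inE eqxx expn1.
Qed.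

Lemma basis_inj : injective basis.
Proof.
move=> p q e; have : basis p q = basis q q by rewrite e.
by rewrite /basis !fsfunE !inE eqxx; case: eqVneq.
Qed.

(** The generators embed in the monoid with the same norm. *)
Lemma finite_primes (x : R) : finite_set (upto N [set: freeM P] x) ->
  finite_set [set l | (N l)%:R <= x].
Proof.
move=> fx.
have -> : [set l | (N l)%:R <= x] = basis @^-1` upto N [set: freeM P] x.
  by apply/seteqP; split => l /=; rewrite /upto /= normM_basis; [|case].
by apply: finite_preimage => // p q _ _; exact: basis_inj.
Qed.

(** If the set were infinite at a large x, its [ncard] would be 0 and the asymptotic would give
    kappa x <= k x^theta. This fails once x^(1 - theta) > k/kappa, and such an x can be taken above
    any [z]. *)
Lemma finite_upto (X : set R) (kappa theta : R) : ProperFilter (infty X) ->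
  0 < kappa -> 0 <= theta < 1 ->
  (fun x : R => cupto N [set: freeM P] x) =
     (fun x : R => kappa * x) +O_ (infty X) (fun x : R => x `^ theta) ->
  forall (S : set (freeM P)) (z : R), finite_set (upto N S z).
Proof.
move=> PF k0 /andP[t0 t1] /eqaddOP [k0' [_ hk]] S z.
pose k := Num.max (k0' + 1) 1.
have kk : k0' < k by rewrite lt_max ltrDl ltr01.
have {hk} h := hk k kk.
have k1 : 0 < k by rewrite lt_max ltr01 orbT.
have [x [zx [x1 [xk hx]]]] : exists x, z <= x /\ 1 < x /\ k / kappa < x `^ (1 - theta) /\
   `|(cupto N [set: freeM P] x) - kappa * x| <= k * `|x `^ theta|.
  have [x] := @filter_ex _ _ PF _ (filterI (filterI (near_infty_ge X z) (near_infty_ge X 2))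
    (filterI (near_infty_ge X ((k / kappa + 1) `^ (1 - theta)^-1)) h)).
  move=> [[h1 h2] [h3 h4]]; exists x; split => //; split; first by apply: lt_le_trans h2; lra.
  split => //.
  have kk0 : 0 <= k / kappa by rewrite divr_ge0 ?ltW.
  apply: (@lt_le_trans _ _ (k / kappa + 1)); first by rewrite ltrDl.
  have t1' : 1 - theta != 0 by rewrite subr_eq0 gt_eqF.
  have -> : k / kappa + 1 = ((k / kappa + 1) `^ (1 - theta)^-1) `^ (1 - theta).
    by rewrite -powRrM mulVf// powRr1// addr_ge0.
  apply: ge0_ler_powR => //; rewrite ?nnegrE ?powR_ge0 ?subr_ge0 ?(ltW t1)//.
  exact: le_trans (powR_ge0 _ _) h3.
have x0 : 0 < x by exact: lt_trans x1.
have fx : finite_set (upto N [set: freeM P] x).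
  apply/not_notP => inf; move: hx.
  rewrite {1}/cupto /ncard (infinite_fset_set inf) cardfs0 sub0r normrN.
  rewrite ger0_norm ?(mulr_ge0 (ltW k0) (ltW x0))// ger0_norm ?powR_ge0//.
  apply/negP; rewrite -ltNge.
  have p0 : 0 < x `^ theta by exact: powR_gt0.
  have xE : x = x `^ (1 - theta) * x `^ theta.
    by rewrite -powRD ?subrK ?powRr1 ?(ltW x0)// gt_eqF// implybT.
  have : k / kappa * x `^ theta < x by rewrite [ltRHS]xE ltr_pM2r.
  by rewrite mulrAC ltr_pdivrMr// (mulrC x).
apply: sub_finite_set fx => m [_ mz]; split => //; exact: le_trans zx.
Qed.
End FreeMonoid.
Section LittleO.
Context {R : realType} (X : set R).
Local Notation L x := (ln (ln x)).

Lemma powR_half_loglog (x : R) : 0 <= L x -> L x `^ (1 / 2) = Num.sqrt (L x).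
Proof. by move=> h; rewrite div1r powR12_sqrt. Qed.

Lemma near_le_cvg_ratio (g : R -> R) :
  (forall e : R, 0 < e -> \forall x \near infty X, `|g x| <= e * `|L x `^ (1 / 2)|) ->
  g x / Num.sqrt (L x) @[x --> infty X] --> 0.
Proof.
move=> h; apply/cvgr0Pnorm_le => e e0.
apply: filterS (filterI (h e e0) (near_infty_loglog X 1)) => x [h1 L1].
have L0 : 0 <= L x by exact: le_trans L1.
have s0 : 0 < Num.sqrt (L x) by rewrite sqrtr_gt0; exact: lt_le_trans L1.
rewrite normrM normfV (ger0_norm (ltW s0)) ler_pdivrMr//.
by move: h1; rewrite powR_half_loglog// (ger0_norm (ltW s0)).
Qed.

Lemma littleo_cvg_ratio (g : R -> R) :
  g =o_ (infty X) (fun x => L x `^ (1 / 2)) ->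
  g x / Num.sqrt (L x) @[x --> infty X] --> 0.
Proof. by move=> /eqoP h; apply: near_le_cvg_ratio => e e0; exact: h. Qed.

Lemma addlittleo_cvg_ratio (g : R -> R) :
  g = (fun x => L x) +o_ (infty X) (fun x => L x `^ (1 / 2)) ->
  (g x - L x) / Num.sqrt (L x) @[x --> infty X] --> 0.
Proof.
move=> /eqaddoP h.
by apply: (@near_le_cvg_ratio (fun x => g x - L x)) => e e0; exact: h.
Qed.

Lemma littleo_power (g : R -> R) (K r : nat) : (2 * K <= r)%N ->
  g =o_ (infty X) (fun x => L x `^ (- (r%:R / 2))) ->
  L x ^+ K * g x @[x --> infty X] --> 0.
Proof.
move=> Kr /eqoP h; apply/cvgr0Pnorm_le => e e0.
apply: filterS (filterI (h e e0) (near_infty_loglog X 1)) => x [h1 L1].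
have L0 : 0 < L x by exact: lt_le_trans L1.
rewrite normrM (ger0_norm (exprn_ge0 _ (ltW L0))).
apply: (@le_trans _ _ (L x ^+ K * (e * `|L x `^ (- (r%:R / 2))|))).
  by rewrite ler_wpM2l// exprn_ge0// ltW.
rewrite mulrCA ler_piMr ?(ltW e0)// ger0_norm ?powR_ge0//.
rewrite -powR_mulrn ?(ltW L0)// -powRD; last by apply/implyP => _; rewrite gt_eqF.
rewrite -[leRHS](powRr0 (L x)); apply: ler_powR => //.
have : (2 * K)%:R <= r%:R :> R by rewrite ler_nat.
by rewrite natrM; lra.
Qed.

End LittleO.

(** * Averages over S(x) and the count of small primes *)

Section Sample.
Context {R : realType} {P : choiceType} (N : P -> nat) (X : set R).
Variables (S : set (freeM P)) (f : freeM P -> freeM P) (lam : P -> R) (y : R -> R).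
Hypothesis fin : forall (T : set (freeM P)) (z : R), finite_set (upto N T z).

Definition avg (x : R) (G : freeM P -> R) : R :=
  (\sum_(m <- fset_set (upto N S x)) G m) / cupto N S x.

Lemma avgD x G H : avg x (fun m => G m + H m) = avg x G + avg x H.
Proof. by rewrite /avg big_split mulrDl. Qed.

Lemma avgZ x c G : avg x (fun m => c * G m) = c * avg x G.
Proof. by rewrite /avg -big_distrr mulrA. Qed.

Lemma avg_sum (I : Type) (r : seq I) x (G : I -> freeM P -> R) :
  avg x (fun m => \sum_(i <- r) G i m) = \sum_(i <- r) avg x (G i).
Proof. by rewrite /avg exchange_big /= big_distrl. Qed.

Lemma avg_le x G H : (forall m, upto N S x m -> G m <= H m) -> avg x G <= avg x H.
Proof.
move=> GH; rewrite /avg ler_wpM2r ?invr_ge0 ?ler0n//.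
rewrite big_seq [leRHS]big_seq; apply: ler_sum => m.
by rewrite in_fset_set// inE => /GH.
Qed.

Lemma avg_ncard x (Q : freeM P -> Prop) :
  (ncard [set m | upto N S x m /\ Q m])%:R / cupto N S x = avg x (fun m => (`[< Q m >])%:R).
Proof. by rewrite ncard_sep. Qed.

Lemma avg1 x : 0 < cupto N S x -> avg x (fun=> 1) = 1.
Proof.
move=> c0; rewrite /avg big_const_seq count_predT iter_addr addr0.
by rewrite /cupto /ncard in c0 *; rewrite divff// gt_eqF.
Qed.

Lemma near_cupto_gt0 : infinite_set S -> \forall x \near infty X, 0 < cupto N S x.
Proof.
move=> iS; have [m Sm] : exists m, S m.
  by apply/set0P/eqP => S0; apply: iS; rewrite S0; exact: finite_set0.
apply: filterS (near_infty_ge X (normM N m)%:R) => x xm.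
rewrite /cupto ltr0n /ncard cardfs_gt0; apply/fset0Pn; exists m.
by rewrite in_fset_set// inE.
Qed.

Definition small_primes x : seq P := fset_set [set l | (N l)%:R <= y x].

Lemma mem_small_primes x l : (l \in small_primes x) <-> (N l)%:R <= y x.
Proof.
rewrite /small_primes in_fset_set; last exact: finite_primes.
by rewrite inE.
Qed.

Lemma uniq_small_primes x : uniq (small_primes x).
Proof. exact: fset_uniq. Qed.

Lemma sum_small_primes x (G : P -> R) :
  \sum_(l \in [set l | (N l)%:R <= y x]) G l = \sum_(l <- small_primes x) G l.
Proof. by rewrite fsbig_finite//; exact: finite_primes. Qed.

Definition omega_small x (m : freeM P) : nat := size [seq l <- small_primes x | (1 <= f m l)%N].

Definition count_avg x (g : nat -> R) : R := avg x (fun m => g (omega_small x m)).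

Lemma count_avg_mean x : 0 < cupto N S x -> is_count_mean (count_avg x).
Proof.
move=> c0; split => [|g h|c g|g h gh]; first exact: avg1.
- exact: avgD.
- exact: avgZ.
- by apply: avg_le => m _; exact: gh.
Qed.

Lemma errE t x : err N S f lam t x =
  avg x (fun m => (all (fun l => (1 <= f m l)%N) t)%:R) - \prod_(l <- t) lam l.
Proof.
rewrite /err avg_ncard; congr (avg x _ - _); apply/funext => m; congr (_%:R).
by congr nat_of_bool; apply/asboolP/allP.
Qed.

(** The falling factorial of the count is the number of words of distinct small primes all dividing
    f(m). Exchanging the sums gives, for each word, its product of lambdas plus its error. *)
Lemma count_avg_ffact x u : count_avg x (fun n => (n ^_ u)%:R)
   - \sum_(t <- uniq_words u (small_primes x)) \prod_(l <- t) lam l =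
  \sum_(t <- uniq_words u (small_primes x)) err N S f lam t x.
Proof.
have us := uniq_small_primes x.
rewrite (eq_bigr _ (fun t _ => errE t x)) sumrB; congr (_ - _).
rewrite -avg_sum; congr avg; apply/funext => m.
rewrite -(@sum_uniq_words _ R u (small_primes x)) ?filter_uniq//; last first.
  by move=> l; rewrite mem_filter => /andP[].
rewrite big_seq [RHS]big_seq; apply: eq_bigr => t.
rewrite mem_uniq_words => /and3P[_ _ /allP ts]; congr (_%:R); congr nat_of_bool.
apply: eq_in_all => l lt; rewrite /= mem_filter; move: (ts l lt) => /= ->.
by rewrite andbT.
Qed.

Hypothesis hf : forall r u : nat, (0 < r)%N -> (1 <= u <= r)%N ->
        (fun x : R =>
           \sum_(t \in [set t : u.-tuple P | uniq t /\
                          forall i : 'I_u, (N (tnth t i))%:R <= y x])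
             `|err N S f lam t x|)
        =o_ (infty X) (fun x : R => (ln (ln x)) `^ (- (r%:R / 2))).

Lemma cvg_sum_err u K : (0 < u)%N ->
  ln (ln x) ^+ K * \sum_(t <- uniq_words u (small_primes x)) `|err N S f lam t x|
  @[x --> infty X] --> 0.
Proof.
(* The exponent r = u + 2K meets both demands: u <= r, and L^K times L^(-r/2) stays bounded. *)
move=> u0; have := @hf (u + 2 * K) u; rewrite addn_gt0 u0 leq_addr => /(_ isT isT).
move=> /(littleo_power (leq_addl _ _)) h.
apply: cvg_trans h; apply: near_eq_cvg; apply: nearW => x; congr (_ * _).
exact: (@sum_tuples_words R P u _ _ (fun t => `|err N S f lam t x|)
  (uniq_small_primes x) (mem_small_primes x)).
Qed.

Hypothesis hC : \forall x \near infty X, 0 < cupto N S x.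

Lemma cvg_count_avg_ffact u K : ln (ln x) ^+ K * (count_avg x (fun n => (n ^_ u)%:R)
   - \sum_(t <- uniq_words u (small_primes x)) \prod_(l <- t) lam l) @[x --> infty X] --> 0.
Proof.
(* Hypothesis (f) starts at u = 1. For u = 0 the only word is empty and its error is 1 - 1 = 0. *)
case: u => [|u].
  apply: cvg_near_cst; apply: filterS hC => x c0.
  by rewrite count_avg_ffact big_seq1 errE big_nil /= avg1// subrr mulr0.
have h := @cvg_sum_err u.+1 K (ltn0Sn u).
apply: (@cvg_dist_le _ _ _ _ _ (fun x => ln (ln x) ^+ K *
  \sum_(t <- uniq_words u.+1 (small_primes x)) `|err N S f lam t x|)) => //.
apply: filterS (near_infty_loglog X 0) => x L0.
rewrite subr0 count_avg_ffact normrM ger0_norm ?exprn_ge0// ler_wpM2l ?exprn_ge0//.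
exact: ler_norm_sum.
Qed.

Hypothesis hd : (fun x : R => \sum_(l \in [set l | (N l)%:R <= y x]) lam l) =
        (fun x : R => ln (ln x))
          +o_ (infty X) (fun x : R => (ln (ln x)) `^ (1 / 2)).

Lemma cvg_sum_lam : (\sum_(l <- small_primes x) lam l - ln (ln x)) / Num.sqrt (ln (ln x))
  @[x --> infty X] --> 0.
Proof.
apply: cvg_trans (addlittleo_cvg_ratio hd); apply: near_eq_cvg; apply: nearW => x.
by rewrite sum_small_primes.
Qed.

(** If y(x) < N(l), the sum of the lambdas over small primes is at most a constant [K] depending
    only on [l], whereas (d) makes it at least L - sqrt(L). Absolute values enter [K] because the
    signs of the lambdas are not yet known. *)
Lemma near_mem_small_primes l : \forall x \near infty X, l \in small_primes x.
Proof.
pose T : {fset P} := fset_set [set l' | (N l')%:R <= (N l)%:R :> R].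
pose K := \sum_(l' <- T) `|lam l'|.
have /cvgr0Pnorm_le/(_ _ ltr01) h := cvg_sum_lam.
(* The second square gives sqrt(L) >= K + 2, hence L - sqrt(L) >= (K + 2)(K + 1) > K; the first
   makes L positive. *)
apply: filterS (filterI h (near_infty_loglog X ((K + 1) ^+ 2 + (K + 2) ^+ 2))) => x [h1 h2].
rewrite mem_small_primes leNgt; apply/negP => yl.
have K0 : 0 <= K by rewrite sumr_ge0.
have sK : \sum_(l <- small_primes x) lam l <= K.
  apply: (@le_trans _ _ (\sum_(l <- small_primes x) `|lam l|)).
    by apply: ler_sum => l' _; exact: ler_norm.
  have sub : {subset small_primes x <= T}.
    move=> l' /mem_small_primes l'y; rewrite in_fset_set ?inE /=; last exact: finite_primes.
    exact: le_trans l'y (ltW yl).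
  suff -> : K = \sum_(l <- small_primes x ++ [seq l <- T | l \notin small_primes x]) `|lam l|.
    by rewrite big_cat /= lerDl sumr_ge0.
  apply: perm_big; apply: uniq_perm; rewrite ?fset_uniq//.
    rewrite cat_uniq uniq_small_primes filter_uniq ?fset_uniq// andbT.
    by apply/hasPn => l'; rewrite mem_filter => /andP[].
  move=> l'; rewrite mem_cat mem_filter.
  by case: (boolP (l' \in small_primes x)) => // /sub ->.
set L := ln (ln x) in h1 h2.
have L0 : 0 < L by apply: lt_le_trans h2; rewrite ltr_pwDl ?exprn_gt0 ?sqr_ge0// ltr_wpDl.
have s0 : 0 < Num.sqrt L by rewrite sqrtr_gt0.
have sL : Num.sqrt L ^+ 2 = L by rewrite sqr_sqrtr// ltW.
move: h1; rewrite normrM normfV (ger0_norm (ltW s0)) ler_pdivrMr// mul1r ler_norml => /andP[h3 _].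
have s2 : K + 2 <= Num.sqrt L.
  rewrite -(ler_pXn2r (n := 2)) ?nnegrE ?addr_ge0 ?(ltW s0)// sL.
  by apply: le_trans h2; rewrite lerDr sqr_ge0.
nra.
Qed.

Hypothesis PF : ProperFilter (infty X).

(** An average of indicators lies in [0, 1] and differs from lam l by an error that can be made
    arbitrarily small, as [l] is eventually a one-letter word in the sum of (f). *)
Lemma lam_itv l : 0 <= lam l <= 1.
Proof.
have he (e : R) : 0 < e -> exists2 x, 0 < cupto N S x & `|err N S f lam [:: l] x| <= e.
  move=> e0; have /cvgr0Pnorm_le/(_ _ e0) h := @cvg_sum_err 1 0 isT.
  have [x [[c0 lx] h1]] := @filter_ex _ _ PF _ (filterI (filterI hC (near_mem_small_primes l)) h).
  exists x => //; move: h1; rewrite expr0 mul1r ger0_norm ?sumr_ge0//; apply: le_trans.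
  have lw : [:: l] \in uniq_words 1 (small_primes x) by rewrite mem_uniq_words /= lx.
  rewrite (big_rem _ lw) /= lerDl sumr_ge0//.
have b x : 0 < cupto N S x ->
    0 <= avg x (fun m => (all (fun l => (1 <= f m l)%N) [:: l])%:R) <= 1.
  move=> c0; apply/andP; split.
    have -> : 0 = avg x (fun=> 0 * 1) by rewrite avgZ mul0r.
    by apply: avg_le => m _; rewrite mul0r.
  by rewrite -[leRHS](avg1 c0); apply: avg_le => m _; case: (all _ _).
apply/andP; split; rewrite leNgt; apply/negP => h.
- have h2 : 0 < - lam l / 2 by lra.
  have [x c0] := he _ h2; rewrite errE big_seq1 ler_norml.
  by have /andP[b0 b1] := b x c0 => /andP[_]; lra.
- have h2 : 0 < (lam l - 1) / 2 by lra.
  have [x c0] := he _ h2; rewrite errE big_seq1 ler_norml.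
  by have /andP[b0 b1] := b x c0 => /andP[+ _]; lra.
Qed.

Hypothesis he : (fun x : R => \sum_(l \in [set l | (N l)%:R <= y x]) lam l ^+ 2)
        =o_ (infty X) (fun x : R => (ln (ln x)) `^ (1 / 2)).

Lemma omega_small_clt c :
  avg x (fun m => \1_(below c) (((omega_small x m)%:R - ln (ln x)) / Num.sqrt (ln (ln x))))
   @[x --> infty X] --> Phi c.
Proof.
have h2 : (\sum_(l <- small_primes x) lam l ^+ 2) / Num.sqrt (ln (ln x)) @[x --> infty X] --> 0.
  apply: cvg_trans (littleo_cvg_ratio he); apply: near_eq_cvg; apply: nearW => x.
  by rewrite sum_small_primes.
have hM : \forall x \near infty X, is_count_mean (count_avg x).
  by apply: filterS hC => x; exact: count_avg_mean.
exact: (moment_clt lam_itv uniq_small_primes hM (@cvg_loglog R X) cvg_sum_lam h2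
  cvg_count_avg_ffact).
Qed.

End Sample.

(** * Passing between the normalizations by log log x and log log N(m) *)

Section Sandwich.
Context {R : realType}.

Lemma sqrt_sub_le1 (L l : R) : 0 <= l -> L - 1 <= l <= L ->
  Num.sqrt l <= Num.sqrt L <= Num.sqrt l + 1.
Proof.
move=> l0 /andP[Ll lL]; have L0 : 0 <= L by exact: le_trans lL.
rewrite ler_sqrt// lL /=.
rewrite -(ler_pXn2r (n := 2)) ?nnegrE ?sqrtr_ge0 ?addr_ge0 ?sqrtr_ge0//.
have := sqrtr_ge0 l.
have -> : (Num.sqrt l + 1) ^+ 2 = Num.sqrt l ^+ 2 + 2 * Num.sqrt l + 1 by ring.
by rewrite !sqr_sqrtr//; lra.
Qed.

(** Here W, T, U stand for the counts of small, middle and large primes. Discarding T, U >= 0 only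
    helps, and changing l to L in the square root costs at most |c|. *)
Lemma normalized_le_trans (L l W T U C c d : R) : 0 < l -> L - 1 <= l <= L -> 0 < L ->
  0 <= T -> 0 <= U <= C -> 2 * (C + 1 + `|c|) <= d * Num.sqrt L ->
  (W + T + U - l) / Num.sqrt l <= c -> (W - L) / Num.sqrt L <= c + d.
Proof.
move=> l0 Ll L0 T0 /andP[U0 UC] hd; have /andP[s1 s2] := sqrt_sub_le1 (ltW l0) Ll.
have sl0 : 0 < Num.sqrt l by rewrite sqrtr_gt0.
have sL0 : 0 < Num.sqrt L by rewrite sqrtr_gt0.
case/andP: Ll => Ll1 Ll2.
rewrite !ler_pdivrMr// => h.
have : c * Num.sqrt l <= c * Num.sqrt L + `|c|.
  rewrite -lerBlDl -mulrBr (le_trans (ler_norm _))// normrM ler_piMr//.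
  by rewrite ler_norml; apply/andP; split; lra.
have := normr_ge0 c; nra.
Qed.

(** The margin d sqrt(L) is split in two: one half pays for T, the other for C + 1 + |c|, that is
    for U, for L - l and for the change of square root. This explains the factor 2 in the
    hypothesis. *)
Lemma normalized_le_trans_rev (L l W T U C c d : R) : 0 < l -> L - 1 <= l <= L -> 0 < L ->
  T <= d / 2 * Num.sqrt L -> 0 <= U <= C -> 2 * (C + 1 + `|c|) <= d * Num.sqrt L ->
  (W - L) / Num.sqrt L <= c - d -> (W + T + U - l) / Num.sqrt l <= c.
Proof.
move=> l0 Ll L0 hT /andP[U0 UC] hd; have /andP[s1 s2] := sqrt_sub_le1 (ltW l0) Ll.
have sl0 : 0 < Num.sqrt l by rewrite sqrtr_gt0.
have sL0 : 0 < Num.sqrt L by rewrite sqrtr_gt0.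
case/andP: Ll => Ll1 Ll2.
rewrite !ler_pdivrMr// => h.
have : c * Num.sqrt L <= c * Num.sqrt l + `|c|.
  rewrite -lerBlDl -mulrBr (le_trans (ler_norm _))// normrM ler_piMr//.
  by rewrite ler_norml; apply/andP; split; lra.
nra.
Qed.

(** Above the square root of x, ln n >= (ln x)/2, so the iterated logarithm drops by at most ln 2 <=
    1. Positivity follows from ln x >= e > 2. *)
Lemma loglog_itv (x n : R) : 0 < x -> 1 <= ln (ln x) -> x `^ (1 / 2) < n <= x ->
  0 < ln (ln n) /\ ln (ln x) - 1 <= ln (ln n) <= ln (ln x).
Proof.
move=> x0 L1 /andP[h1 h2].
have n0 : 0 < n by exact: le_lt_trans (powR_ge0 _ _) h1.
have lx0 : 0 < ln x by rewrite ltNge; apply/negP => h; move: L1; rewrite ln0//; lra.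
have lx : 2 < ln x.
  have := expR_gt1Dx (oner_neq0 R); have : expR 1 <= expR (ln (ln x)) by rewrite ler_expR.
  by rewrite lnK ?posrE//; lra.
have l3 : ln x / 2 <= ln n.
  by rewrite -ler_expR (lnK n0) (le_trans _ (ltW h1))// /powR gt_eqF// div1r mulrC.
have ln0 : 1 < ln n by lra.
have ln2 : ln n <= ln x by rewrite ler_ln.
split; first by rewrite ln_gt0.
rewrite (ler_ln (x := ln n)) ?posrE; [|lra|lra]; rewrite ln2 andbT.
have : ln (ln x / 2) <= ln (ln n) by rewrite ler_ln ?posrE; lra.
rewrite lnM ?posrE ?lnV ?posrE ?invr_gt0//.
by have := @ln_le_sub R 2; lra.
Qed.

End Sandwich.

(** * Splitting omega into small, middle and large primes *)

Section Omega.
Context {R : realType} {P : choiceType} (N : P -> nat) (X : set R).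
Variables (S : set (freeM P)) (f : freeM P -> freeM P) (lam : P -> R) (beta : R) (y : R -> R).
Hypothesis fin : forall (T : set (freeM P)) (z : R), finite_set (upto N T z).

Definition middle_primes x : seq P := fset_set [set l | y x < (N l)%:R <= x `^ beta].

Lemma finite_middle_primes x : finite_set [set l | y x < (N l)%:R <= x `^ beta].
Proof. by apply: sub_finite_set (finite_primes (fin _ (x `^ beta))) => l /= /andP[]. Qed.

Definition omega_middle x (m : freeM P) : R := \sum_(l <- middle_primes x) (1 <= f m l)%N%:R.

Definition omega_large x (m : freeM P) : nat :=
  ncard [set l | (x `^ beta < (N l)%:R)%R /\ (1 <= f m l)%N].

Lemma finite_support (m : freeM P) : finite_set [set l | (1 <= m l)%N].
Proof.
have -> : [set l | (1 <= m l)%N] = [set` finsupp m].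
  by apply/seteqP; split => l /=; rewrite mem_finsupp lt0n.
exact: finite_fset.
Qed.

(** All three counts are rewritten over the finite support of f(m), where each prime falls in
    exactly one range; y(x) < x^beta excludes an overlap of the outer two. *)
Lemma omega_split x (m : freeM P) : y x < x `^ beta ->
  (omega (f m))%:R = (omega_small N f y x m)%:R + omega_middle x m + (omega_large x m)%:R :> R.
Proof.
move=> yx; have fE := finite_support (f m).
pose E := fset_set [set l | (1 <= f m l)%N].
have swap (A : set P) : finite_set A ->
    \sum_(l <- fset_set A) (1 <= f m l)%N%:R = \sum_(l <- E) `[< A l >]%:R :> R.
  move=> fA; rewrite -ncard_sep//.
  have -> : [set l | (1 <= f m l)%N /\ A l] = [set l | A l /\ (1 <= f m l)%N].
    by apply/seteqP; split => l [].
  by rewrite ncard_sep//; apply: eq_bigr => l _; rewrite asboolb.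
have -> : (omega_small N f y x m)%:R = \sum_(l <- E) `[< (N l)%:R <= y x >]%:R :> R.
  rewrite -(swap [set l | (N l)%:R <= y x]); last exact: finite_primes.
  rewrite /omega_small size_filter -sum1_count natr_sum big_mkcond /=.
  by apply: eq_bigr => l _; case: ifP.
rewrite /omega_middle swap; last exact: finite_middle_primes.
have -> : (omega_large x m)%:R = \sum_(l <- E) `[< x `^ beta < (N l)%:R >]%:R :> R.
  rewrite -ncard_sep// /omega_large; congr (ncard _)%:R.
  by apply/seteqP; split => l [].
rewrite -!big_split /= /omega /ncard -/E -sum1_size natr_sum; apply: eq_bigr => l _.
rewrite !asboolb.
have [h1|h1] := leP (N l)%:R (y x); have [h2|h2] := leP (N l)%:R (x `^ beta) => /=;
  rewrite ?addr0 ?add0r//.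
by have := lt_trans yx (lt_le_trans h2 h1); rewrite ltxx.
Qed.

Hypothesis hC : \forall x \near infty X, 0 < cupto N S x.
Hypothesis hb : (fun x : R =>
           \sum_(l \in [set l | y x < (N l)%:R <= x `^ beta]) lam l)
        =o_ (infty X) (fun x : R => (ln (ln x)) `^ (1 / 2)).
Hypothesis hc : (fun x : R =>
           \sum_(l \in [set l | y x < (N l)%:R <= x `^ beta])
             `|err N S f lam [:: l] x|)
        =o_ (infty X) (fun x : R => (ln (ln x)) `^ (1 / 2)).

(** The frequency of l dividing f(m) is lambda_l plus e_l(x) by definition of the error, so the
    first moment is the sum of the quantities in (b) and (c). *)
Lemma cvg_avg_omega_middle :
  avg N S x (omega_middle x) / Num.sqrt (ln (ln x)) @[x --> infty X] --> 0.
Proof.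
have hb' := littleo_cvg_ratio hb; have hc' := littleo_cvg_ratio hc.
have fm x := finite_middle_primes x.
have nhb : `|(\sum_(l \in [set l | y x < (N l)%:R <= x `^ beta]) lam l) / Num.sqrt (ln (ln x))|
    @[x --> infty X] --> 0.
  by rewrite -[X in _ --> X](@normr0 _ R); exact: cvg_norm hb'.
apply: (@cvg_dist_le _ _ _ _ _ _ _ _ (_ : (fun x => _ + _) @ _ --> 0)); last first.
  by rewrite -[X in _ --> X](addr0 (0 : R)); exact: cvgD nhb hc'.
apply: nearW => x; rewrite subr0.
have -> : avg N S x (omega_middle x) =
    \sum_(l <- middle_primes x) lam l + \sum_(l <- middle_primes x) err N S f lam [:: l] x.
  rewrite avg_sum -big_split; apply: eq_bigr => l _ /=.
  rewrite errE// big_seq1 addrC subrK; congr avg.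
  by apply/funext => m; rewrite /= andbT.
rewrite !fsbig_finite// mulrDl (le_trans (ler_normD _ _))// lerD//.
rewrite normrM (ger0_norm (_ : 0 <= (Num.sqrt _)^-1)) ?invr_ge0 ?sqrtr_ge0//.
by rewrite ler_wpM2r ?invr_ge0 ?sqrtr_ge0//; exact: ler_norm_sum.
Qed.
End Omega.

(** * Assembly: pointwise comparison of indicators and passage to the limit *)

Theorem theorem1p1 (R : realType) (P : countType) (N : P -> nat)
  (hN : forall p, (1 < N p)%N)
  (X : set R)
  (hX : X = range (fun r : rat => ratr r : R) \/
        exists2 q : nat, (0 < q)%N & X = range (fun z : int => (q%:R : R) ^ z))
  (hNX : forall m : freeM P, X (normM N m)%:R)
  (kappa theta : R) (hkappa : 0 < kappa) (htheta : 0 <= theta < 1)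
  (hcount : (fun x : R => cupto N [set: freeM P] x) =
            (fun x : R => kappa * x) +O_ (infty X) (fun x : R => x `^ theta))
  (S : set (freeM P)) (hSinf : infinite_set S)
  (hShalf : (fun x : R => cupto N S (x `^ (1 / 2))) =o_ (infty X)
            (fun x : R => cupto N S x))
  (f : freeM P -> freeM P) (lam : P -> R)
  (beta : R) (hbeta : 0 < beta <= 1)
  (y : R -> R) (hy : forall x, X x -> 1 < x -> y x < x `^ beta)
  (ha : exists C : nat, \forall x \near infty X, forall m, upto N S x m ->
        (ncard [set l | (x `^ beta < (N l)%:R)%R /\ (1 <= f m l)%N] <= C)%N)
  (hb : (fun x : R =>
           \sum_(l \in [set l | y x < (N l)%:R <= x `^ beta]) lam l)
        =o_ (infty X) (fun x : R => (ln (ln x)) `^ (1 / 2)))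
  (hc : (fun x : R =>
           \sum_(l \in [set l | y x < (N l)%:R <= x `^ beta])
             `|err N S f lam [:: l] x|)
        =o_ (infty X) (fun x : R => (ln (ln x)) `^ (1 / 2)))
  (hd : (fun x : R => \sum_(l \in [set l | (N l)%:R <= y x]) lam l) =
        (fun x : R => ln (ln x))
          +o_ (infty X) (fun x : R => (ln (ln x)) `^ (1 / 2)))
  (he : (fun x : R => \sum_(l \in [set l | (N l)%:R <= y x]) lam l ^+ 2)
        =o_ (infty X) (fun x : R => (ln (ln x)) `^ (1 / 2)))
  (hf : forall r u : nat, (0 < r)%N -> (1 <= u <= r)%N ->
        (fun x : R =>
           \sum_(t \in [set t : u.-tuple P | uniq t /\
                          forall i : 'I_u, (N (tnth t i))%:R <= y x])
             `|err N S f lam t x|)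
        =o_ (infty X) (fun x : R => (ln (ln x)) `^ (- (r%:R / 2)))) :
  forall gamma : R,
    (ncard [set m | upto N S x m /\ (3 <= normM N m)%N /\
              ((omega (f m))%:R - ln (ln (normM N m)%:R))
                / Num.sqrt (ln (ln (normM N m)%:R)) <= gamma])%:R
      / cupto N S x @[x --> infty X] --> Phi gamma.
Proof.
move=> gamma.
(* For q = 1 the set X = {1} is bounded and the limit is vacuous. *)
have [F0|nF0] := pselect (infty X set0).
  by move=> A _; apply: filterS F0 => x [].
have PF : ProperFilter (infty X) by apply: Build_ProperFilter_ex => A FA;
  apply/not_existsP => nA; apply: nF0; apply: filterS FA => x Ax; exact: nA x Ax.
have fin : forall (T : set (freeM P)) (z : R), finite_set (upto N T z).
  exact: finite_upto PF hkappa htheta hcount.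
have hC := @near_cupto_gt0 R P N X S fin hSinf.
have clt := @omega_small_clt R P N X S f lam y fin hf hC hd PF he.
have mid := @cvg_avg_omega_middle R P N X S f lam beta y fin hb hc.
have [C hCa] := ha.
case/andP: hbeta => beta0 beta1.
pose Q (m : freeM P) := (3 <= normM N m)%N /\
  ((omega (f m))%:R - ln (ln (normM N m)%:R)) / Num.sqrt (ln (ln (normM N m)%:R)) <= gamma.
pose bad1 (x : R) (m : freeM P) : R := `[< (normM N m)%:R <= x `^ (1 / 2) >]%:R.
apply/cvgrPdist_le => e e0.
(* Each side incurs four losses of at most d: the limit theorem for small primes, the shift of
   gamma, the elements with N(m) <= x^(1/2), and the middle primes. *)
pose d := e / 5.
have d0 : 0 < d by rewrite divr_gt0.
have d0' := ltW d0.
have /cvgrPdist_le/(_ _ d0) clt1 := clt (gamma + d).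
have /cvgrPdist_le/(_ _ d0) clt2 := clt (gamma - d).
(* Markov's inequality at the level (d/2) sqrt(L) then leaves an exceptional proportion of at most
   d. *)
have e2 : 0 < d * (d / 2) by rewrite mulr_gt0// divr_gt0.
have /cvgr0Pnorm_le/(_ _ e2) mid1 := mid.
have half : \forall x \near infty X, avg N S x (bad1 x) <= d.
  move/eqoP : hShalf => /(_ _ d0) h.
  apply: filterS (filterI (filterI h hC) (near_infty_ge X 1)) => x [[h1 c0] x1].
  rewrite -avg_ncard// ler_pdivrMr//.
  move: h1; rewrite !ger0_norm ?ler0n//; apply: le_trans.
  rewrite /cupto ler_nat; apply: ncard_le => // m [[Sm _] mx]; by split.
have bigL := near_infty_loglog X (Num.max 1 ((2 * (C%:R + 1 + `|gamma|) / d) ^+ 2)).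
near=> x.
(* Guarantees x > 1 and x^(1/2) >= 3, so that N(m) >= 3 holds automatically once N(m) > x^(1/2). *)
have x16 : 16 <= x by near: x; exact: near_infty_ge.
have x0 : 0 < x by lra.
have Xx : X x by near: x; exact: near_infty_in.
have yx : y x < x `^ beta by apply: hy => //; lra.
have c0 : 0 < cupto N S x by near: x.
have : Num.max 1 ((2 * (C%:R + 1 + `|gamma|) / d) ^+ 2) <= ln (ln x) by near: x.
rewrite ge_max => /andP[L1 L2].
have L0 : 0 < ln (ln x) by exact: lt_le_trans L1.
have s0 : 0 < Num.sqrt (ln (ln x)) by rewrite sqrtr_gt0.
have hd2 : 2 * (C%:R + 1 + `|gamma|) <= d * Num.sqrt (ln (ln x)).
  rewrite [leRHS]mulrC -ler_pdivrMr// -[leLHS]ger0_norm ?divr_ge0 ?mulr_ge0 ?addr_ge0 ?(ltW e0)//.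
  by rewrite -sqrtr_sqr ler_sqrt// ltW.
have hU m : upto N S x m -> (omega_large N f beta x m <= C)%N by move: m; near: x.
have x3 : 3 <= x `^ (1 / 2).
  have -> : 3 = (9 : R) `^ (1 / 2).
    by rewrite div1r powR12_sqrt// (_ : 9 = 3 ^+ 2) ?sqrtr_sqr ?ger0_norm//; ring.
  by apply: ge0_ler_powR; rewrite ?nnegrE ?divr_ge0//; lra.
have hmid : `|avg N S x (omega_middle N f beta y x) / Num.sqrt (ln (ln x))| <= d * (d / 2) by near: x.
have hbad1 : avg N S x (bad1 x) <= d by near: x.
have b1 : `|Phi (gamma + d) - avg N S x (fun m => \1_(below (gamma + d))
  (((omega_small N f y x m)%:R - ln (ln x)) / Num.sqrt (ln (ln x))))| <= d by near: x.
have b2 : `|Phi (gamma - d) - avg N S x (fun m => \1_(below (gamma - d))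
  (((omega_small N f y x m)%:R - ln (ln x)) / Num.sqrt (ln (ln x))))| <= d by near: x.
pose Z m : R := ((omega_small N f y x m)%:R - ln (ln x)) / Num.sqrt (ln (ln x)).
pose T m := omega_middle N f beta y x m.
have T0 m : 0 <= T m by rewrite sumr_ge0.
(* Markov's majorant: it exceeds 1 as soon as the middle primes number more than (d/2) sqrt(L). *)
pose tail m := (d / 2 * Num.sqrt (ln (ln x)))^-1 * T m.
have th0 : 0 < d / 2 * Num.sqrt (ln (ln x)) by rewrite mulr_gt0 ?divr_gt0.
have tail0 m : 0 <= tail m by rewrite mulr_ge0// invr_ge0 ltW.
have htail : avg N S x tail <= d.
  rewrite /tail avgZ mulrC ler_pdivrMr//.
  by move: hmid => /(le_trans (ler_norm _)); rewrite ler_pdivrMr// -/T; lra.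
have typical m : upto N S x m -> ~~ `[< (normM N m)%:R <= x `^ (1 / 2) >] ->
    [/\ (3 <= normM N m)%N, 0 < ln (ln (normM N m)%:R : R) &
        ln (ln x) - 1 <= ln (ln (normM N m)%:R : R) <= ln (ln x)].
  move=> [Sm mx] /asboolPn/negP; rewrite -ltNge => h.
  have [h1 h2] : 0 < ln (ln (normM N m)%:R : R) /\
      ln (ln x) - 1 <= ln (ln (normM N m)%:R : R) <= ln (ln x).
    by apply: loglog_itv => //; rewrite h.
  by split => //; rewrite -(ler_nat R) (le_trans x3)// ltW.
have up m : upto N S x m -> `[< Q m >]%:R <= \1_(below (gamma + d)) (Z m) + (bad1 x m + tail m).
  move=> um; have [[Q1 Q2]|nQ] := asboolP (Q m); last first.
    by rewrite addr_ge0 ?indicE ?ler0n// addr_ge0// /bad1 ler0n.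
  rewrite /bad1; case: (boolP `[< (normM N m)%:R <= x `^ (1 / 2) >]) => [_|h].
    by rewrite addrC -addrA lerDl addr_ge0 ?indicE ?ler0n.
  have [m3 l0 Ll] := typical m um h.
  rewrite indicE mem_set ?lerDl ?add0r//=.
  apply: (normalized_le_trans l0 Ll L0 (T0 m) (U := (omega_large N f beta x m)%:R) (C := C%:R)) => //.
    by rewrite ler0n ler_nat hU.
  by rewrite -omega_split.
have down m : upto N S x m -> \1_(below (gamma - d)) (Z m) <= `[< Q m >]%:R + (bad1 x m + tail m).
  move=> um; rewrite indicE; have [|_] := boolP (_ \in _); last first.
    by rewrite addr_ge0 ?ler0n// addr_ge0// /bad1 ler0n.
  rewrite inE /below /= => Zm.
  rewrite /bad1; case: (boolP `[< (normM N m)%:R <= x `^ (1 / 2) >]) => [_|h].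
    by rewrite addrCA lerDl addr_ge0 ?ler0n.
  (* Too many middle primes are paid for by [tail]; otherwise the reverse comparison of
     normalizations applies. *)
  have [Tm|Tm] := leP (T m) (d / 2 * Num.sqrt (ln (ln x))); last first.
    rewrite add0r; apply: (@le_trans _ _ (tail m)); last by rewrite lerDr ler0n.
    by rewrite /tail mulrC ler_pdivlMr// mul1r ltW.
  have [m3 l0 Ll] := typical m um h.
  have -> : `[< Q m >] = true.
    apply/asboolP; split => //.
    rewrite (omega_split f fin m yx).
    apply: (normalized_le_trans_rev l0 Ll L0 Tm (C := C%:R) _ hd2 Zm).
    by rewrite ler0n ler_nat hU.
  by rewrite lerDl addr_ge0.
have a1 := avg_le fin up; have a2 := avg_le fin down.
rewrite !avgD in a1 a2.
rewrite (avg_ncard _ fin _ Q).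
have /andP[p1 p2] := Phi_lipschitz gamma d0'.
have /andP[p3 p4] := Phi_lipschitz (gamma - d) d0'.
rewrite subrK in p3 p4.
move: b1 b2; rewrite !ler_norml => /andP[b1 b1'] /andP[b2 b2'].
have e5 : e = 5 * d by rewrite /d; field.
by rewrite e5; apply/andP; split; lra.
Unshelve. all: by end_near. Qed.
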